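(* Every symmetrical partial action of a Hopf algebra $H$ (over a field $\Bbbk$) on an idempotent algebra is Morita equivalent to a partial action of $H$ on an idempotent algebra with trivial right (or left) annihilator.
   Context: Algebras are associative $\Bbbk$-algebras, not necessarily unital; an algebra $A$ is idempotent if $A^2=A$, where $A^2$ is the span of all products; $\Delta(h)=\sum h_{(1)}\otimes h_{(2)}$ is the comultiplication of $H$. Right annihilator: $r(A)=\{a\in A: ba=0\ \forall b\in A\}$; left annihilator: $l(A)=\{b\in A: ba=0\ \forall a\in A\}$; an annihilator is trivial if it is $0$. A partial action of $H$ on $A$ is a linear map $\cdot:H\otimes A\to A$ with, for all $a,b\in A$, $h,k\in H$: $1_H\cdot a=a$ and $h\cdot(a(k\cdot b))=\sum(h_{(1)}\cdot a)(h_{(2)}k\cdot b)$; $A$ is then a partial $H$-module algebra. It is symmetrical if also $h\cdot((k\cdot b)a)=\sum(h_{(1)}k\cdot b)(h_{(2)}\cdot a)$. A Morita context $(A,B,{}_AM_B,{}_BN_A,\tau,\sigma)$ consists of algebras $A,B$, bimodules $M,N$, and bimodule maps $\tau:M\otimes_BN\to A$, $\sigma:N\otimes_AM\to B$ with $\tau(m\otimes n)m'=m\,\sigma(n\otimes m')$ and $\sigma(n\otimes m)n'=n\,\tau(m\otimes n')$; it is strict if $\tau,\sigma$ are surjective. A bimodule ${}_AM_B$ is unital if $AM=M=MB$. The context algebra is $C=\begin{pmatrix}A&M\\N&B\end{pmatrix}$ with matrix multiplication defined via the bimodule structures, $\tau$ and $\sigma$. Partial actions $\cdot_A$ of $H$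 on $A$ and $\cdot_B$ of $H$ on $B$ are Morita equivalent if: (1) there is a strict Morita context $(A,B,{}_AM_B,{}_BN_A,\tau,\sigma)$ with $M,N$ unital bimodules; (2) there is a partial action of $H$ on the context algebra $C$ whose restrictions to $\begin{pmatrix}A&0\\0&0\end{pmatrix}$ and $\begin{pmatrix}0&0\\0&B\end{pmatrix}$ coincide with $\cdot_A$ and $\cdot_B$ respectively. *)

(* Defs.v *)
From HB Require Import structures.
From mathcomp Require Import all_boot all_order all_algebra ring_quotient.
From mathcomp Require Import finmap boolp.
From mathcomp.multinomials Require Import monalg.

Set Implicit Arguments.
Unset Strict Implicit.
Unset Printing Implicit Defensive.

Import GRing.Theory.
Local Open Scope ring_scope.
Local Open Scope quotient_scope.

Notation bilin f := (bilinear_for *:%R *:%R f).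

Inductive lspan (k : fieldType) (V : lmodType k) (S : V -> Prop) : V -> Prop :=
| lspan_gen v : S v -> lspan S v
| lspan0 : lspan S 0
| lspan_lin c u v : lspan S u -> lspan S v -> lspan S (c *: u + v).

Definition lspan_pred (k : fieldType) (V : lmodType k) (S : V -> Prop) : {pred V} :=
  [pred v : V | `[< lspan S v >]].

Section LQuot.
Variables (k : fieldType) (V : lmodType k) (S : V -> Prop).

Lemma lspan_predP v : reflect (lspan S v) (v \in lspan_pred S).
Proof. by rewrite inE; apply: asboolP. Qed.

Fact lspan_zmod_closed : zmod_closed (lspan_pred S).
Proof.
split=> [|u v /lspan_predP hu /lspan_predP hv]; apply/lspan_predP.
  exact: lspan0.
by rewrite addrC -scaleN1r; apply: lspan_lin.
Qed.
HB.instance Definition _ := GRing.isZmodClosed.Build V (lspan_pred S) lspan_zmod_closed.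

(* The quotient of V by the linear span of S. *)
Definition lquot := Quotient.quot (lspan_pred S).
HB.instance Definition _ := GRing.Zmodule.on lquot.

Definition lpi (v : V) : lquot := \pi_(lquot) v.

Lemma lpi_eq u v : lpi u = lpi v <-> lspan S (u - v).
Proof.
rewrite /lpi; split=> [/eqP|h]; last first.
  by apply/eqP; rewrite -Quotient.idealrBE; apply/lspan_predP.
by rewrite -Quotient.idealrBE => /lspan_predP.
Qed.

Definition lrepr (x : lquot) : V := repr x.
Lemma lreprK : cancel lrepr lpi. Proof. exact: reprK. Qed.

Lemma lpiD u v : lpi (u + v) = lpi u + lpi v.
Proof. by rewrite /lpi !piE. Qed.

Definition lquot_scale (c : k) (x : lquot) : lquot := lpi (c *: lrepr x).

Lemma lpiZ c v : lquot_scale c (lpi v) = lpi (c *: v).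
Proof.
apply/lpi_eq; rewrite -scalerBr -[X in lspan _ X]addr0.
by apply: lspan_lin; [apply/lpi_eq; rewrite lreprK | exact: lspan0].
Qed.

Fact lquot_scaleA a b x : lquot_scale a (lquot_scale b x) = lquot_scale (a * b) x.
Proof. by rewrite -[x]lreprK !lpiZ scalerA. Qed.
Fact lquot_scale1 : left_id 1 lquot_scale.
Proof. by move=> x; rewrite -[x]lreprK !lpiZ scale1r. Qed.
Fact lquot_scaleDr : right_distributive lquot_scale +%R.
Proof.
move=> a x y; rewrite -[x]lreprK -[y]lreprK !lpiZ -!lpiD lpiZ.
by rewrite scalerDr.
Qed.
Fact lquot_scaleDl x : {morph lquot_scale^~ x : a b / a + b}.
Proof. by move=> a b; rewrite /= -[x]lreprK !lpiZ -lpiD scalerDl. Qed.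

HB.instance Definition _ := GRing.Zmodule_isLmodule.Build k lquot
  lquot_scaleA lquot_scale1 lquot_scaleDr lquot_scaleDl.

Fact lpi_is_linear : linear lpi.
Proof. by move=> c u v; rewrite lpiD -lpiZ. Qed.
HB.instance Definition _ := GRing.isLinear.Build k V lquot _ lpi lpi_is_linear.

Lemma lpi_killed v : S v -> lpi v = 0.
Proof.
by move=> Sv; rewrite -[0](linear0 lpi); apply/lpi_eq; rewrite subr0; apply: lspan_gen.
Qed.

Lemma lquot_lift (U : lmodType k) (f : {linear V -> U}) :
  (forall v, S v -> f v = 0) -> forall v, f (lrepr (lpi v)) = f v.
Proof.
move=> f0 v; suff h u : lspan S u -> f u = 0.
  apply/eqP; rewrite -subr_eq0 -linearB.
  by apply/eqP/h/lpi_eq; rewrite lreprK.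
elim=> [w /f0 //| |c x y _ hx _ hy]; first by rewrite linear0.
by rewrite linearP hx hy scaler0 addr0.
Qed.

End LQuot.

Section FreeLift.
Variables (k : fieldType) (I : choiceType) (U : lmodType k) (f : I -> U).

Definition flift (x : {malg k[I]}) : U := \sum_(i <- msupp x) x@_i *: f i.

Lemma fliftEw (d : {fset I}) x : (msupp x `<=` d)%fset ->
  flift x = \sum_(i <- d) x@_i *: f i.
Proof.
move=> le; rewrite /flift; apply: big_fset_incl => // i _ /mcoeff_outdom ->.
by rewrite scale0r.
Qed.

Fact flift_is_linear : linear flift.
Proof.
move=> c x y; pose d := (msupp x `|` msupp y `|` msupp (c *: x + y))%fset.
rewrite (@fliftEw d) ?fsubsetUr // (@fliftEw d x) ?(@fliftEw d y); last first.
- by rewrite /d -fsetUA fsubsetUl.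
- by rewrite /d fsetUAC fsubsetUr.
rewrite scaler_sumr -big_split; apply: eq_bigr => i _ /=.
by rewrite mcoeffD mcoeffZ scalerDl scalerA.
Qed.
HB.instance Definition _ := GRing.isLinear.Build k {malg k[I]} U _ flift flift_is_linear.

Lemma fliftU i : flift << i >> = f i.
Proof. by rewrite /flift msuppU oner_eq0 big_seq_fset1 mcoeffUU scale1r. Qed.

End FreeLift.

Section Tensor.
Variables (k : fieldType) (V W : lmodType k).

Inductive tensor_rel : {malg k[(V * W)%type]} -> Prop :=
| tensor_rel_l c v v' w :
    tensor_rel (<< (c *: v + v', w) >> - (c *: << (v, w) >> + << (v', w) >>))
| tensor_rel_r c v w w' :
    tensor_rel (<< (v, c *: w + w') >> - (c *: << (v, w) >> + << (v, w') >>)).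

Definition tensor := lquot tensor_rel.
HB.instance Definition _ := GRing.Lmodule.on tensor.

Definition tens (v : V) (w : W) : tensor := lpi tensor_rel << (v, w) >>.

Lemma tens_bilin : bilin tens.
Proof.
split=> [w c v v'|v c w w']; apply/eqP; rewrite -subr_eq0 /tens /=.
- by rewrite -linearP -linearB; apply/eqP/lpi_killed; exact: tensor_rel_l.
- by rewrite -linearP -linearB; apply/eqP/lpi_killed; exact: tensor_rel_r.
Qed.

(* The map out of the tensor product induced by f; it is only meaningful when
   f is bilinear (see tlift_tens and tlift_is_linear), which is the case in
   every use below.  When t = \sum v_i ⊗ w_i, it returns \sum f v_i w_i. *)
Definition tlift (U : lmodType k) (f : V -> W -> U) (t : tensor) : U :=
  flift (fun p => f p.1 p.2) (lrepr t).

Lemma tlift_lpi (U : lmodType k) (f : V -> W -> U) : bilin f ->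
  forall x, tlift f (lpi tensor_rel x) = flift (fun p => f p.1 p.2) x.
Proof.
move=> [fl fr] x; rewrite /tlift; apply: lquot_lift => {x} x [c v v' w|c v w w'].
- by rewrite linearB linearP /= !fliftU /= fl subrr.
- by rewrite linearB linearP /= !fliftU /= fr subrr.
Qed.

Lemma tlift_tens (U : lmodType k) (f : V -> W -> U) v w :
  bilin f -> tlift f (tens v w) = f v w.
Proof. by move=> fb; rewrite tlift_lpi // fliftU. Qed.

Lemma tlift_is_linear (U : lmodType k) (f : V -> W -> U) :
  bilin f -> linear (tlift f).
Proof.
move=> fb c x y; rewrite -[x]lreprK -[y]lreprK -linearP !tlift_lpi //.
by rewrite linearP.
Qed.

Lemma tensP (t : tensor) :
  exists s : seq (V * W), t = \sum_(p <- s) tens p.1 p.2.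
Proof.
rewrite -[t]lreprK; set x := lrepr t; move: x => {t} x.
exists [seq (x@_p *: p.1, p.2) | p <- enum_fset (msupp x)].
rewrite big_map [in LHS](monalgE x) linear_sum; apply: eq_bigr => p _ /=.
have -> : << x@_p *g p >> = x@_p *: << p >> :> {malg k[(V * W)%type]}.
  by apply/malgP => q; rewrite mcoeffZ !mcoeffU mulrnAr mulr1.
rewrite linearZ /= -[x@_p *: p.1]addr0 (tens_bilin.1 p.2).
have -> : tens 0 p.2 = 0.
  have /= := tens_bilin.1 p.2 (-1) 0 0.
  by rewrite scaler0 addr0 scaleN1r addNr.
by rewrite addr0 /tens -surjective_pairing.
Qed.

End Tensor.

Notation "V ⊗ W" := (tensor V W) (at level 40, left associativity) : type_scope.
Notation "v ⊗ w" := (tens v w) (at level 40, left associativity) : ring_scope.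

HB.mixin Record Lmodule_isNuAlgebra (k : fieldType) A of GRing.Lmodule k A := {
  numul : A -> A -> A;
  numulA : associative numul;
  numul_bilin : bilin numul
}.

#[short(type="nuAlgType")]
HB.structure Definition NuAlgebra (k : fieldType) :=
  {A of GRing.Lmodule k A & Lmodule_isNuAlgebra k A}.

Notation "a ∙ b" := (numul a b) (at level 40, left associativity) : ring_scope.

Definition idempotent_alg (k : fieldType) (A : nuAlgType k) : Prop :=
  forall x : A, lspan (fun y => exists a b, y = a ∙ b) x.

Definition right_annihilator (k : fieldType) (A : nuAlgType k) (a : A) : Prop :=
  forall b : A, b ∙ a = 0.

Definition left_annihilator (k : fieldType) (A : nuAlgType k) (b : A) : Prop :=
  forall a : A, b ∙ a = 0.

Definition trivial_right_annihilator (k : fieldType) (A : nuAlgType k) : Prop :=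
  forall a : A, right_annihilator a -> a = 0.

Definition trivial_left_annihilator (k : fieldType) (A : nuAlgType k) : Prop :=
  forall a : A, left_annihilator a -> a = 0.

(* The product of the tensor square of an algebra:
   (a ⊗ b)(c ⊗ d) = ac ⊗ bd. *)
Definition tensor_mul (k : fieldType) (H : algType k) (s t : H ⊗ H) : H ⊗ H :=
  tlift (fun a b => tlift (fun c d => (a * c) ⊗ (b * d)) t) s.

(* Through tlift, Sweedler's \sum F(h_(1), h_(2)) is tlift F (comul h).  A Hopf
   algebra has 1 <> 0 because counit 1 = 1, so algType loses no generality. *)
HB.mixin Record Algebra_isHopf (k : fieldType) H of GRing.Algebra k H := {
  comul : {linear H -> (H ⊗ H)%type};
  counit : {linear H -> k^o};
  antipode : {linear H -> H};
  comulA : forall h : H,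
    tlift (fun x y => tlift (fun x1 x2 => x1 ⊗ (x2 ⊗ y)) (comul x)) (comul h)
    = tlift (fun x y => x ⊗ comul y) (comul h);
  counit_comul : forall h : H, tlift (fun x y => counit x *: y) (comul h) = h;
  comul_counit : forall h : H, tlift (fun x y => counit y *: x) (comul h) = h;
  comul1 : comul 1 = 1 ⊗ 1;
  comulM : forall g h : H, comul (g * h) = tensor_mul (comul g) (comul h);
  counit1 : counit 1 = 1;
  counitM : forall g h : H, counit (g * h) = counit g * counit h;
  antipodel : forall h : H, tlift (fun x y => antipode x * y) (comul h) = (counit h)%:A;
  antipoder : forall h : H, tlift (fun x y => x * antipode y) (comul h) = (counit h)%:A
}.

#[short(type="hopfAlgType")]
HB.structure Definition HopfAlgebra (k : fieldType) :=
  {H of GRing.Algebra k H & Algebra_isHopf k H}.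

Section PartialActions.
Variables (k : fieldType) (H : hopfAlgType k) (A : nuAlgType k).
Implicit Type act : {linear (H ⊗ A)%type -> A}.

Definition partial_action act : Prop :=
  (forall a, act (1 ⊗ a) = a) /\
  (forall (h g : H) (a b : A),
     act (h ⊗ (a ∙ act (g ⊗ b))) =
     tlift (fun h1 h2 => act (h1 ⊗ a) ∙ act ((h2 * g) ⊗ b)) (comul h)).

Definition symmetrical_partial_action act : Prop :=
  partial_action act /\
  (forall (h g : H) (a b : A),
     act (h ⊗ (act (g ⊗ b) ∙ a)) =
     tlift (fun h1 h2 => act ((h1 * g) ⊗ b) ∙ act (h2 ⊗ a)) (comul h)).

End PartialActions.

Record bimodule (k : fieldType) (A B : nuAlgType k) := Bimodule {
  bimod_sort :> lmodType k;
  lact : A -> bimod_sort -> bimod_sort;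
  ract : bimod_sort -> B -> bimod_sort;
  lact_bilin : bilin lact;
  ract_bilin : bilin ract;
  lactA : forall a a' m, lact (a ∙ a') m = lact a (lact a' m);
  ractA : forall m b b', ract m (b ∙ b') = ract (ract m b) b';
  lractA : forall a m b, ract (lact a m) b = lact a (ract m b)
}.

Notation "a ⋅l m" := (lact a m) (at level 40, left associativity) : ring_scope.
Notation "m ⋅r b" := (ract m b) (at level 40, left associativity) : ring_scope.

Definition unital_bimodule (k : fieldType) (A B : nuAlgType k) (M : bimodule A B) : Prop :=
  (forall x : M, lspan (fun y => exists (a : A) (m : M), y = a ⋅l m) x) /\
  (forall x : M, lspan (fun y => exists (m : M) (b : B), y = m ⋅r b) x).

Section TensorOver.
Variables (k : fieldType) (A B C : nuAlgType k) (M : bimodule A B) (N : bimodule B C).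

Definition balanced_rel (t : M ⊗ N) : Prop :=
  exists (m : M) (b : B) (n : N), t = (m ⋅r b) ⊗ n - m ⊗ (b ⋅l n).

Definition tensor_over := lquot balanced_rel.
HB.instance Definition _ := GRing.Lmodule.on tensor_over.

Definition tens_over (m : M) (n : N) : tensor_over := lpi balanced_rel (m ⊗ n).

Lemma tens_over_bilin : bilin tens_over.
Proof.
split=> [n c m m'|m c n n']; rewrite /tens_over /=.
  by rewrite (tens_bilin _ _).1 linearP.
by rewrite (tens_bilin _ _).2 linearP.
Qed.

Lemma tens_over_balanced m b n : tens_over (m ⋅r b) n = tens_over m (b ⋅l n).
Proof.
apply/eqP; rewrite -subr_eq0 -linearB; apply/eqP/lpi_killed.
by exists m, b, n.
Qed.

End TensorOver.

Notation "m ⊗b n" := (tens_over m n) (at level 40, left associativity) : ring_scope.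

Record morita_context (k : fieldType) (A B : nuAlgType k) := MoritaContext {
  mcM : bimodule A B;
  mcN : bimodule B A;
  mcτ : {linear tensor_over mcM mcN -> A};
  mcσ : {linear tensor_over mcN mcM -> B};
  mcτl : forall a m n, mcτ ((a ⋅l m) ⊗b n) = a ∙ mcτ (m ⊗b n);
  mcτr : forall m n a, mcτ (m ⊗b (n ⋅r a)) = mcτ (m ⊗b n) ∙ a;
  mcσl : forall b n m, mcσ ((b ⋅l n) ⊗b m) = b ∙ mcσ (n ⊗b m);
  mcσr : forall n m b, mcσ (n ⊗b (m ⋅r b)) = mcσ (n ⊗b m) ∙ b;
  mcτσ : forall m n m', mcτ (m ⊗b n) ⋅l m' = m ⋅r mcσ (n ⊗b m');
  mcστ : forall n m n', mcσ (n ⊗b m) ⋅l n' = n ⋅r mcτ (m ⊗b n')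
}.

Definition strict_context (k : fieldType) (A B : nuAlgType k) (X : morita_context A B) : Prop :=
  (forall a, exists t, mcτ X t = a) /\ (forall b, exists t, mcσ X t = b).

Section ContextAlgebra.
Variables (k : fieldType) (A B : nuAlgType k) (X : morita_context A B).
Local Notation M := (mcM X).
Local Notation N := (mcN X).

(* ((a, m), (n, b)) stands for the matrix with rows (a m) and (n b). *)
Definition context_alg : Type := ((A * M) * (N * B))%type.
HB.instance Definition _ := GRing.Lmodule.on context_alg.

Definition context_mul (x y : context_alg) : context_alg :=
  let: ((a, m), (n, b)) := x in let: ((a', m'), (n', b')) := y in
  ((a ∙ a' + mcτ X (m ⊗b n'), a ⋅l m' + m ⋅r b'),
   (n ⋅r a' + b ⋅l n', mcσ X (n ⊗b m') + b ∙ b')).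

Lemma context_mulA : associative context_mul.
Proof.
move=> [[a m] [n b]] [[a' m'] [n' b']] [[a2 m2] [n2 b2]] /=.
have Dl (U V W : lmodType k) (f : U -> V -> W) (fb : bilin f) x y z :
  f (x + y) z = f x z + f y z by have := fb.1 z 1 x y; rewrite /= !scale1r.
have Dr (U V W : lmodType k) (f : U -> V -> W) (fb : bilin f) x y z :
  f z (x + y) = f z x + f z y by have := fb.2 z 1 x y; rewrite /= !scale1r.
have nb := @numul_bilin k; have lb := @lact_bilin k; have rb := @ract_bilin k.
have tb := @tens_over_bilin k.
rewrite !(Dl _ _ _ _ (nb _)) !(Dr _ _ _ _ (nb _)) !(Dl _ _ _ _ (lb _ _ _)).
rewrite !(Dr _ _ _ _ (lb _ _ _)) !(Dl _ _ _ _ (rb _ _ _)) !(Dr _ _ _ _ (rb _ _ _)).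
rewrite !(Dl _ _ _ _ (tb _ _ _ _ _)) !(Dr _ _ _ _ (tb _ _ _ _ _)) !linearD /=.
rewrite !numulA !lactA !ractA !lractA -!mcτl -!mcτr -!mcσl -!mcσr !mcτσ !mcστ.
rewrite !tens_over_balanced.
congr ((_, _), (_, _)); rewrite -?addrA; congr (_ + _); rewrite ?addrA;
  congr (_ + _); exact: addrC.
Qed.

Lemma context_mul_bilin : bilin context_mul.
Proof.
have tb := @tens_over_bilin k.
split.
- move=> [[a m] [n b]] c [[a' m'] [n' b']] [[a2 m2] [n2 b2]] /=.
  rewrite numul_bilin.1 numul_bilin.1 !(lact_bilin _).1 !(ract_bilin _).1.
  rewrite !(tb _ _ _ _ _).1 !linearP /=.
  congr ((_, _), (_, _)); rewrite /= scalerDr addrACA; done.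
- move=> [[a m] [n b]] c [[a' m'] [n' b']] [[a2 m2] [n2 b2]] /=.
  rewrite numul_bilin.2 numul_bilin.2 !(lact_bilin _).2 !(ract_bilin _).2.
  rewrite !(tb _ _ _ _ _).2 !linearP /=.
  congr ((_, _), (_, _)); rewrite /= scalerDr addrACA; done.
Qed.

HB.instance Definition _ :=
  Lmodule_isNuAlgebra.Build k context_alg context_mulA context_mul_bilin.

Definition context_inA (a : A) : context_alg := ((a, 0), (0, 0)).
Definition context_inB (b : B) : context_alg := ((0, 0), (0, b)).

End ContextAlgebra.

Definition partial_morita_equivalent (k : fieldType) (H : hopfAlgType k)
    (A B : nuAlgType k) (actA : {linear (H ⊗ A)%type -> A})
    (actB : {linear (H ⊗ B)%type -> B}) : Prop :=
  exists X : morita_context A B,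
    [/\ strict_context X, unital_bimodule (mcM X), unital_bimodule (mcN X) &
     exists actC : {linear (H ⊗ context_alg X)%type -> context_alg X},
       [/\ partial_action actC,
           forall h a, actC (h ⊗ context_inA X a) = context_inA X (actA (h ⊗ a)) &
           forall h b, actC (h ⊗ context_inB X b) = context_inB X (actB (h ⊗ b))]].

(* Main.v *)
Require Import Defs.
From HB Require Import structures.
From mathcomp Require Import all_boot all_order all_algebra.
From mathcomp Require Import boolp classical_sets functions.

Set Implicit Arguments.
Unset Strict Implicit.
Unset Printing Implicit Defensive.

Import GRing.Theory.
Local Open Scope ring_scope.

(* B consists of the finite rank operators n' |-> n.m(n') on N attached to a pairing
   M x N -> A.  Then l(B) = 0 for free, and r(B) = 0 as soon as no n <> 0 satisfies
   A m(n) = 0 for all m.  The obvious choice B = A/r(A) fails: unless the antipode is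
   bijective, r(A) need not be H-stable.  Instead let U be the free H-module on the
   words in A.  An element of N is a family n(l) in H ⊗ A, indexed by words l, such that
   n(l) is the sum over the letters a of the images of n(a l) under the absorption
   g ⊗ b |-> g_(1) ⊗ (g_(2).a) b; it is a compatible sequence of elements of U ⊗ A, one
   for each word length.  M is spanned by the maps n |-> a.(xi ⊗ id)(n(l)) with xi a
   linear functional on H.  If A m(n) = 0 for all m, then all n(l) lie in H ⊗ r(A),
   which absorption kills, so n = 0.  H acts diagonally on H ⊗ A; absorption is
   equivariant because the action on A is symmetrical, and idempotence of A provides
   such a family whose value at the empty word is 1 ⊗ b, for each b. *)

(** * Linear algebra *)

Section LinearAlgebra.
Variable k : fieldType.
Implicit Types U V W : lmodType k.

Lemma linear_fun0 U V (f : U -> V) : linear f -> f 0 = 0.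
Proof. by move=> lf; rewrite -(subrr 0) -{1}scaleN1r addrC lf scaleN1r addNr. Qed.

Lemma linear_funD U V (f : U -> V) : linear f -> {morph f : x y / x + y}.
Proof. by move=> lf x y; rewrite -{1}[x]scale1r lf scale1r. Qed.

Lemma linear_funZ U V (f : U -> V) c : linear f -> {morph f : x / c *: x}.
Proof. by move=> lf x; rewrite -[c *: x]addr0 lf linear_fun0 // addr0. Qed.

Lemma linear_fun_sum U V (f : U -> V) : linear f ->
  forall I (r : seq I) P F,
  f (\sum_(i <- r | P i) F i) = \sum_(i <- r | P i) f (F i).
Proof.
move=> lf I r P F; apply: (big_morph f); [exact: linear_funD|exact: linear_fun0].
Qed.

Lemma linear_comp U V W (g : V -> W) (f : U -> V) :
  linear g -> linear f -> linear (fun x => g (f x)).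
Proof. by move=> lg lf c u v; rewrite lf lg. Qed.

Lemma linear_bigsum U V I (r : seq I) P (F : I -> U -> V) :
  (forall i, linear (F i)) -> linear (fun x => \sum_(i <- r | P i) F i x).
Proof.
move=> lF c u v; rewrite scaler_sumr -big_split.
by apply: eq_bigr => i _; rewrite lF.
Qed.

Lemma linear_scale U V c (f : U -> V) : linear f -> linear (fun x => c *: f x).
Proof. by move=> lf a u v; rewrite lf scalerDr !scalerA mulrC. Qed.

Lemma linear_scalel U V (f : U -> k^o) (v : V) :
  linear f -> linear (fun x => (f x : k) *: v).
Proof. by move=> lf a u w; rewrite lf scalerDl scalerA. Qed.

Lemma linear_id U : linear (fun x : U => x). Proof. by []. Qed.

Lemma linear_zero U V : linear (fun _ : U => 0 : V).
Proof. by move=> c u v; rewrite scaler0 addr0. Qed.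

Section Span.
Variables (V : lmodType k) (S : V -> Prop).

Lemma lspanZ c v : lspan S v -> lspan S (c *: v).
Proof. by move=> h; rewrite -[c *: v]addr0; apply: lspan_lin => //; exact: lspan0. Qed.

Lemma lspanD u v : lspan S u -> lspan S v -> lspan S (u + v).
Proof. by move=> hu hv; rewrite -[u]scale1r; apply: lspan_lin. Qed.

Lemma lspan_sum I (r : seq I) (P : pred I) F :
  (forall i, P i -> lspan S (F i)) -> lspan S (\sum_(i <- r | P i) F i).
Proof. by move=> h; elim/big_ind: _ => //; [exact: lspan0|exact: lspanD]. Qed.

Lemma lspan_map W (T : W -> Prop) (f : V -> W) : linear f ->
  (forall v, S v -> lspan T (f v)) -> forall v, lspan S v -> lspan T (f v).
Proof.
move=> lf h v; elim=> [w /h //||c u w _ hu _ hw].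
  by rewrite linear_fun0 //; exact: lspan0.
by rewrite lf; apply: lspan_lin.
Qed.

Lemma lspan_sub (T : V -> Prop) :
  (forall v, S v -> lspan T v) -> forall v, lspan S v -> lspan T v.
Proof. exact: (lspan_map (@linear_id V)). Qed.

Lemma lspan_eq W (f g : V -> W) : linear f -> linear g ->
  (forall v, S v -> f v = g v) -> forall v, lspan S v -> f v = g v.
Proof.
move=> lf lg h v; elim=> [w /h //||c u w _ hu _ hw].
  by rewrite !linear_fun0.
by rewrite lf lg hu hw.
Qed.

End Span.

(** By Zorn, take [D] maximal such that [v] is outside the span of [W] and [D]. That span is then a
    hyperplane complementary to [v], and [xi] is the coordinate along [v]. *)
Lemma lspan_separation V (W : V -> Prop) (v : V) : ~ lspan W v ->
  exists xi : V -> k^o,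
    [/\ linear xi, xi v = 1 & forall w, W w -> xi w = 0].
Proof.
move=> Wv; pose span_with (D : set V) := lspan (fun x => W x \/ D x).
have [F FP totF|D [Dv Dmax]] := @Zorn_bigcup V (fun D => ~ span_with D v).
  (* A vector of the span involves finitely many elements of the union, hence a single member of the
     chain; the first alternative is what remains when the chain is empty. *)
  suff spanF x : span_with (\bigcup_(X in F) X)%classic x ->
      lspan W x \/ exists2 X, F X & span_with X x.
    by move=> /spanF[//|[X /FP]].
  have incl X z : lspan W z -> span_with X z.
    by apply: lspan_sub => w Ww; apply: lspan_gen; left.
  elim=> [y [Wy|[X FX Xy]]||c y z _ hx _ hy].
  - by left; exact: lspan_gen.
  - by right; exists X => //; apply: lspan_gen; right.
  - by left; exact: lspan0.
  have mono (X Y : set V) : (X `<=` Y)%classic ->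
      forall z, span_with X z -> span_with Y z.
    move=> XY; apply: lspan_sub => u [Wu|Xu]; apply: lspan_gen; first by left.
    by right; exact: XY.
  case: hx hy => [hx|[X FX hx]] [hy|[Y FY hy]].
  - by left; apply: lspan_lin.
  - by right; exists Y => //; apply: lspan_lin => //; exact: incl.
  - by right; exists X => //; apply: lspan_lin => //; exact: incl.
  right; have [XY|YX] := totF _ _ FX FY.
    by exists Y => //; apply: lspan_lin => //; exact: mono XY _ _.
  by exists X => //; apply: lspan_lin => //; exact: mono YX _ _.
have coord x : exists c, span_with D (x - c *: v).
  have [Dx|Dx] := pselect (D x).
    by exists 0; rewrite scale0r subr0; apply: lspan_gen; right.
  (* By maximality, adjoining [x] to [D] puts [v] into the span, and [c] is the coefficient of [x]
     there. It cannot vanish, as [v] is outside the span for [D] alone. *)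
  have [c cx] : exists c, span_with D (v - c *: x).
    have : span_with (D `|` [set x])%classic v.
      apply: contrapT; apply: Dmax; split; first by move=> z; left.
      by move=> /(_ x) /(_ (or_intror erefl)).
    have: forall z, span_with (D `|` [set x])%classic z ->
        exists c, span_with D (z - c *: x).
      move=> z; elim=> [y [Wy|[Dy|->]]||a y u _ [c hc] _ [d hd]].
      - by exists 0; rewrite scale0r subr0; apply: lspan_gen; left.
      - by exists 0; rewrite scale0r subr0; apply: lspan_gen; right.
      - by exists 1; rewrite scale1r subrr; exact: lspan0.
      - by exists 0; rewrite scale0r subr0; exact: lspan0.
      exists (a * c + d); rewrite scalerDl opprD addrACA -scalerA -scalerBr.
      exact: lspan_lin.
    by move=> h /h.
  have c0 : c != 0.
    by apply/eqP => c0; apply: Dv; move: cx; rewrite c0 scale0r subr0.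
  exists c^-1; have -> : x - c^-1 *: v = (- c^-1) *: (v - c *: x).
    by rewrite scalerBr scalerA mulNr mulVf // !scaleNr scale1r opprK addrC.
  exact: lspanZ.
have coord_uniq x c d : span_with D (x - c *: v) -> span_with D (x - d *: v) -> c = d.
  move=> hc hd; apply/eqP; rewrite -subr_eq0; apply/negPn/negP => cd; apply: Dv.
  rewrite -[v]scale1r -(mulVf cd) -scalerA; apply: lspanZ.
  have -> : (c - d) *: v = (-1) *: (x - c *: v) + (x - d *: v).
    by rewrite scaleN1r opprB addrA subrK scalerBl.
  exact: lspan_lin.
pose xi x := projT1 (cid (coord x)).
have xiP x : span_with D (x - xi x *: v) by rewrite /xi; case: cid.
exists xi; split=> [c x y||w Ww].
- apply: coord_uniq (xiP _) _.
  rewrite scalerDl opprD addrACA -scalerA -scalerBr; exact: lspan_lin (xiP x) (xiP y).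
- by apply: coord_uniq (xiP _) _; rewrite scale1r subrr; exact: lspan0.
- apply: coord_uniq (xiP _) _.
  by rewrite scale0r subr0; apply: lspan_gen; left.
Qed.

(* If all the slices [\sum xi(x_i) y_i] of a tensor lie in [J], then the tensor
   comes from [X ⊗ J], so a pairing that vanishes on [X × J] kills it. *)
Lemma slice_vanish (X Y Z : lmodType k) (J : Y -> Prop) (b : X -> Y -> Z) (s : seq (X * Y)) :
    bilin b -> J 0 -> (forall c u v, J u -> J v -> J (c *: u + v)) ->
    (forall x y, J y -> b x y = 0) ->
    (forall xi : X -> k^o, linear xi -> J (\sum_(p <- s) xi p.1 *: p.2)) ->
  \sum_(p <- s) b p.1 p.2 = 0.
Proof.
move=> [bl br] J0 Jlin bJ; have [n] := ubnP (size s).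
elim: n s => // n IHn [|[x y] s] /= le_sn Js; first by rewrite big_nil.
rewrite big_cons /=.
(* If [x] depends on the later first factors, its term is distributed over the later terms, which
   shortens the list. Otherwise a functional isolates [x], which puts [y] in [J]. *)
have [xs|xs] := pselect (lspan (fun z => z \in [seq p.1 | p <- s]) x).
  have [c xc] : exists c : nat -> k,
      x = \sum_(i < size s) c i *: (nth 0 [seq p.1 | p <- s] i).
    elim: xs => [z||a u v _ [c ->] _ [d ->]].
    (* The coefficient sits at the first occurrence of [z] only, so repeated entries do no harm. *)
    - move=> xs; exists (fun i => (i == index z [seq p.1 | p <- s])%:R).
      have lt_i : (index z [seq p.1 | p <- s] < size s)%N.
        by rewrite -(size_map fst) index_mem.
      rewrite (bigD1 (Ordinal lt_i)) //= eqxx scale1r nth_index // big1 ?addr0 //.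
      by move=> i ne; rewrite (_ : (_ == _) = false) ?scale0r //; apply/negbTE.
    - by exists (fun=> 0); rewrite big1 // => i _; rewrite scale0r.
    exists (fun i => a * c i + d i); rewrite scaler_sumr -big_split.
    by apply: eq_bigr => i _; rewrite scalerDl scalerA.
  pose s' := [seq ((nth 0 [seq p.1 | p <- s] i), nth 0 [seq p.2 | p <- s] i + c i *: y)
             | i <- iota 0 (size s)].
  have key (W : lmodType k) (g : X -> Y -> W) : bilin g ->
      g x y + \sum_(p <- s) g p.1 p.2 = \sum_(p <- s') g p.1 p.2.
    move=> [gl gr]; rewrite /s' big_map -[size s]subn0 -/(index_iota _ _) big_mkord.
    rewrite (big_nth (0, 0)) big_mkord {1}xc (linear_fun_sum (gl y)) -big_split.
    apply: eq_bigr => i _ /=; rewrite (linear_funD (gr _)) (linear_funZ _ (gr _)).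
    rewrite (linear_funZ _ (gl _)) addrC; congr (_ + _).
    by rewrite !(nth_map (0, 0)).
  rewrite (key _ b (bl, br)).
  apply: IHn => [|xi lxi]; first by rewrite size_map size_iota -ltnS.
  rewrite -(key _ (fun x y => (xi x : k) *: y)).
    by have := Js xi lxi; rewrite big_cons.
  split=> u; first exact: (linear_scalel _ lxi).
  by move=> a v w; rewrite /= scalerDr !scalerA [a * _]mulrC.
have [xi [lxi xi1 xi0]] := lspan_separation xs.
have Jy : J y.
  have := Js _ lxi; rewrite big_cons /= xi1 scale1r big_seq big1 ?addr0 //.
  by move=> p ps; rewrite xi0 ?scale0r //; apply: map_f.
rewrite bJ // add0r; apply: IHn => // eta leta.
(* The [eta]-slice of the tail is that of the whole list minus [eta x *: y], and both lie in [J]. *)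
have := Jlin (- eta x) y _ Jy (Js eta leta).
by rewrite big_cons addrA /= scaleNr addNr add0r.
Qed.

End LinearAlgebra.

(** * Linear spans as modules in their own right *)

Section Subspace.
Variables (k : fieldType) (V : lmodType k) (S : V -> Prop).

Fact lspan_scaler_closed : GRing.scaler_closed (lspan_pred S).
Proof. by move=> c v /lspan_predP Sv; apply/lspan_predP; exact: lspanZ. Qed.
HB.instance Definition _ :=
  GRing.isScaleClosed.Build k V (lspan_pred S) lspan_scaler_closed.

(** A span becomes a type here, so that it can carry the module and algebra structures required of
    [N], [M] and [B] below. *)
Record lsub := LSub { lsub_val :> V; lsub_subproof : lsub_val \in lspan_pred S }.
HB.instance Definition _ := [isSub for lsub_val].
HB.instance Definition _ := [Choice of lsub by <:].
HB.instance Definition _ := [SubChoice_isSubLmodule of lsub by <:].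

Lemma lsubP (x : lsub) : lspan S x. Proof. exact/lspan_predP/lsub_subproof. Qed.

Definition in_lsub v (Sv : lspan S v) : lsub := LSub (introT (lspan_predP S v) Sv).

Lemma lsub_inj (x y : lsub) : x = y :> V -> x = y. Proof. exact: val_inj. Qed.

Lemma lsub_linear c (x y : lsub) : lsub_val (c *: x + y) = c *: lsub_val x + lsub_val y.
Proof. by []. Qed.

Lemma lsub_sum I (r : seq I) (F : I -> lsub) :
  lsub_val (\sum_(i <- r) F i) = \sum_(i <- r) lsub_val (F i).
Proof. by apply: (linear_fun_sum (f := lsub_val)); exact: lsub_linear. Qed.

(** The inner induction runs over all [x] with a given value, because the membership proof packed in
    [x] is arbitrary; [lsub_inj] makes it irrelevant. *)
Lemma lsub_ind_span (P : lsub -> Prop) :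
    (forall v (Sv : S v), P (in_lsub (lspan_gen Sv))) -> P 0 ->
    (forall c x y, P x -> P y -> P (c *: x + y)) -> forall x, P x.
Proof.
move=> Pgen P0 Plin x; have := lsubP x.
suff: forall v, lspan S v -> forall x : lsub, x = v :> V -> P x by move=> h /h; apply.
move=> v; elim=> {x v} [v Sv x xv||c u v Su IHu Sv IHv x xv].
- by rewrite (_ : x = in_lsub (lspan_gen Sv)) //; apply: lsub_inj.
- by move=> x x0; rewrite (_ : x = 0) //; apply: lsub_inj.
rewrite (_ : x = c *: in_lsub Su + in_lsub Sv); last by apply: lsub_inj.
by apply: Plin; [apply: IHu|apply: IHv].
Qed.

End Subspace.

(** * Sweedler sums *)

Lemma eq_linear (k : fieldType) (U V : lmodType k) (f g : U -> V) :
  (forall x, f x = g x) -> linear g -> linear f.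
Proof. by move=> fg lg c x y; rewrite !fg lg. Qed.

Section LinearStep.
Variables (k : fieldType) (U : lmodType k).

Lemma linear_tensl (V W : lmodType k) (f : U -> V) (w : W) :
  linear f -> linear (fun x => f x ⊗ w).
Proof. exact: (linear_comp ((tens_bilin V W).1 w)). Qed.

Lemma linear_tensr (V W : lmodType k) (f : U -> W) (v : V) :
  linear f -> linear (fun x => v ⊗ f x).
Proof. exact: (linear_comp ((tens_bilin V W).2 v)). Qed.

Lemma linear_numull (A : nuAlgType k) (f : U -> A) (b : A) :
  linear f -> linear (fun x => f x ∙ b).
Proof. exact: (linear_comp (numul_bilin.1 b)). Qed.

Lemma linear_numulr (A : nuAlgType k) (f : U -> A) (a : A) :
  linear f -> linear (fun x => a ∙ f x).
Proof. exact: (linear_comp (numul_bilin.2 a)). Qed.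

Lemma linear_mull (H : algType k) (f : U -> H) (b : H) :
  linear f -> linear (fun x => f x * b).
Proof. by move=> lf c u v; rewrite lf mulrDl scalerAl. Qed.

Lemma linear_mulr (H : algType k) (f : U -> H) (a : H) :
  linear f -> linear (fun x => a * f x).
Proof. by move=> lf c u v; rewrite lf mulrDr scalerAr. Qed.

Lemma linear_hom (V W : lmodType k) (g : {linear V -> W}) (f : U -> V) :
  linear f -> linear (fun x => g (f x)).
Proof. by apply: linear_comp; exact: linearP. Qed.

Lemma linear_tlift (V W Z : lmodType k) (F : V -> W -> Z) (f : U -> (V ⊗ W)%type) :
  bilin F -> linear f -> linear (fun x => tlift F (f x)).
Proof. by move=> bF; apply: linear_comp; exact: tlift_is_linear. Qed.

End LinearStep.

Definition trilin (k : fieldType) (U V W Z : lmodType k) (F : U -> V -> W -> Z) :=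
  [/\ forall v w, linear (fun u => F u v w), forall u w, linear (fun v => F u v w)
    & forall u v, linear (fun w => F u v w)].

Lemma tensor_ext (k : fieldType) (V W Z : lmodType k) (f g : (V ⊗ W)%type -> Z) :
    linear f -> linear g -> (forall v w, f (v ⊗ w) = g (v ⊗ w)) ->
  forall t, f t = g t.
Proof.
move=> lf lg fg t; have [s ->] := tensP t.
by rewrite !linear_fun_sum //; apply: eq_bigr.
Qed.

Section Sweedler.
Variables (k : fieldType) (H : hopfAlgType k).
Implicit Types (g h : H) (V W : lmodType k).

(** One decomposition of the comultiplication is fixed for each [h], so that Sweedler sums are
    finite sums over lists. The choice carries no linearity in [h]; for bilinear summands linearity
    is recovered through [tlift_comul]. *)
Definition sweedler h : seq (H * H) := sval (cid (tensP (comul h))).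

Lemma sweedlerE h : comul h = \sum_(p <- sweedler h) p.1 ⊗ p.2.
Proof. by rewrite /sweedler; case: cid. Qed.

(* [Sw h F] is Sweedler's sum [\sum F(h_(1), h_(2))]. *)
Definition Sw V h (F : H -> H -> V) : V := \sum_(p <- sweedler h) F p.1 p.2.

Lemma tlift_comul V h (F : H -> H -> V) : bilin F -> tlift F (comul h) = Sw h F.
Proof.
move=> bF; rewrite sweedlerE (linear_fun_sum (tlift_is_linear bF)).
by apply: eq_bigr => p _; rewrite tlift_tens.
Qed.

Lemma linear_Swl V (U : lmodType k) (F : H -> H -> V) (f : U -> H) :
  bilin F -> linear f -> linear (fun x => Sw (f x) F).
Proof.
move=> bF lf c u v; rewrite -!tlift_comul // lf linearP.
exact: tlift_is_linear.
Qed.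

Lemma linear_Swr V (U : lmodType k) h (F : H -> H -> U -> V) :
  (forall x y, linear (F x y)) -> linear (fun u => Sw h (fun x y => F x y u)).
Proof. by move=> lF; apply: linear_bigsum. Qed.

Lemma Sw_map V W (f : V -> W) h F : linear f -> f (Sw h F) = Sw h (fun x y => f (F x y)).
Proof. by move=> lf; rewrite linear_fun_sum. Qed.

Lemma eq_Sw V h (F G : H -> H -> V) :
  (forall x y, F x y = G x y) -> Sw h F = Sw h G.
Proof. by move=> FG; apply: eq_bigr. Qed.

Lemma Sw_exchange V g h (F : H -> H -> H -> H -> V) :
  Sw g (fun a b => Sw h (F a b)) = Sw h (fun x y => Sw g (fun a b => F a b x y)).
Proof. exact: exchange_big. Qed.

(** The linear map on [H ⊗ (H ⊗ H)] induced by [F] is applied to both sides of [comulA]; the results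
    are the two iterated sums. *)
Lemma SwA V h (F : H -> H -> H -> V) : trilin F ->
  Sw h (fun x y => Sw x (fun u v => F u v y)) = Sw h (fun x y => Sw y (F x)).
Proof.
move=> [F1 F2 F3].
have b2 x : bilin (F x) by split.
have b1 : bilin (fun x t => tlift (F x) t).
  split=> [t c x x'|x]; last exact: tlift_is_linear.
  move: t; apply: tensor_ext => [|c' t t'|v w].
  - exact: tlift_is_linear.
  - by rewrite /= !tlift_is_linear // !scalerDr !scalerA (mulrC c') addrACA.
  by rewrite !tlift_tens // F1.
have := congr1 (tlift (fun x t => tlift (F x) t)) (comulA h).
have bA (y : H) : bilin (fun x1 x2 : H => x1 ⊗ (x2 ⊗ y)).
  split=> u.
  - exact/linear_tensl/linear_id.
  - exact/linear_tensr/linear_tensl/linear_id.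
rewrite [in LHS]tlift_comul; last first.
  split=> u; first by apply: linear_tlift; [exact: bA|exact: linearP].
  apply: eq_linear => [y|] /=; first exact: (tlift_comul _ (bA y)).
  by apply: linear_Swr => x1 x2; exact/linear_tensr/linear_tensr/linear_id.
rewrite [in RHS]tlift_comul; last first.
  split=> u; first exact/linear_tensl/linear_id.
  exact/linear_tensr/linearP.
rewrite !Sw_map; try exact: tlift_is_linear.
under eq_Sw => x y do rewrite tlift_comul //.
under [in RHS]eq_Sw => x y do rewrite tlift_tens // tlift_comul //.
move=> <-; apply: eq_Sw => x y; rewrite Sw_map; last exact: tlift_is_linear.
by apply: eq_Sw => u v; rewrite !tlift_tens.
Qed.

Lemma Sw_counitl V (f : H -> V) h : linear f -> Sw h (fun x y => counit x *: f y) = f h.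
Proof.
move=> lf; rewrite -[in RHS](counit_comul h) tlift_comul; last first.
  split=> u; first exact/linear_scalel/linearP.
  exact/linear_scale/linear_id.
by rewrite Sw_map //; apply: eq_Sw => x y; rewrite (linear_funZ _ lf).
Qed.

Lemma Sw_counitr V (f : H -> V) h : linear f -> Sw h (fun x y => counit y *: f x) = f h.
Proof.
move=> lf; rewrite -[in RHS](comul_counit h) tlift_comul; last first.
  split=> u; first exact/linear_scale/linear_id.
  exact/linear_scalel/linearP.
by rewrite Sw_map //; apply: eq_Sw => x y; rewrite (linear_funZ _ lf).
Qed.

Lemma Sw1 V (F : H -> H -> V) : bilin F -> Sw 1 F = F 1 1.
Proof. by move=> bF; rewrite -tlift_comul // comul1 tlift_tens. Qed.

Lemma SwM V g h (F : H -> H -> V) : bilin F ->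
  Sw (g * h) F = Sw g (fun a b => Sw h (fun c d => F (a * c) (b * d))).
Proof.
move=> bF; have [F1 F2] := bF.
have bM a b : bilin (fun c d : H => (a * c) ⊗ (b * d)).
  split=> u; first exact/linear_tensl/linear_mulr/linear_id.
  exact/linear_tensr/linear_mulr/linear_id.
rewrite -tlift_comul // comulM /tensor_mul tlift_comul; last first.
  split=> u.
    apply: eq_linear => [a|] /=; first exact: (tlift_comul _ (bM a u)).
    by apply: linear_Swr => x y; exact/linear_tensl/linear_mull/linear_id.
  apply: eq_linear => [b|] /=; first exact: (tlift_comul _ (bM u b)).
  by apply: linear_Swr => x y; exact/linear_tensr/linear_mull/linear_id.
rewrite Sw_map; last exact: tlift_is_linear.
apply: eq_Sw => a b; rewrite tlift_comul // Sw_map; last exact: tlift_is_linear.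
by apply: eq_Sw => c d; rewrite tlift_tens.
Qed.

Lemma Sw_antipodel V (f : H -> V) h : linear f ->
  Sw h (fun x y => f (antipode x * y)) = counit h *: f 1.
Proof.
move=> lf; rewrite -(linear_funZ _ lf) -antipodel tlift_comul ?Sw_map //.
split=> u; first exact/linear_mull/linearP.
exact/linear_mulr/linear_id.
Qed.

Lemma Sw_antipoder V (f : H -> V) h : linear f ->
  Sw h (fun x y => f (x * antipode y)) = counit h *: f 1.
Proof.
move=> lf; rewrite -(linear_funZ _ lf) -antipoder tlift_comul ?Sw_map //.
split=> u; first exact/linear_mull/linear_id.
exact/linear_mulr/linearP.
Qed.

End Sweedler.

(* The dispatch is on the syntax because unification would unfold [tens]. *)
Ltac lin_base := lazymatch goal with |- GRing.linear_for _ ?F => match F with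
  | (fun x => x) => exact: linear_id
  | (fun x => tens (@?f x) ?w) => refine (@linear_tensl _ _ _ _ f w _)
  | (fun x => tens ?v (@?f x)) => refine (@linear_tensr _ _ _ _ f v _)
  | (fun x => numul (@?f x) ?b) => refine (@linear_numull _ _ _ f b _)
  | (fun x => numul ?a (@?f x)) => refine (@linear_numulr _ _ _ f a _)
  | (fun x => GRing.mul (@?f x) ?b) => refine (@linear_mull _ _ _ f b _)
  | (fun x => GRing.mul ?a (@?f x)) => refine (@linear_mulr _ _ _ f a _)
  | (fun x => GRing.scale ?c (@?f x)) => apply: linear_scale
  | (fun x => GRing.scale (@?f x) ?v) => refine (@linear_scalel _ _ _ f v _)
  | (fun x => Sw ?h (@?f x)) => apply: linear_Swr => ? ?
  | (fun x => Sw (@?f x) ?F) => apply: linear_Swl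
  | (fun x => GRing.Linear.sort _ (@?f x)) =>
      refine (@linear_hom _ _ _ _ _ f _)
  end end.
Ltac lin_hyp := match goal with L : context [GRing.linear_for] |- _ => apply: L end.
Ltac lin_step := first [ lin_base | eassumption | lin_hyp ].
Ltac lin_eta := lazymatch goal with
  | |- GRing.linear_for _ (fun _ => _) => fail
  | |- @GRing.linear_for ?R ?U ?V ?s ?f => change (@GRing.linear_for R U V s (fun x => f x))
  end.
(** Proves linearity by descending through the operations to the variable; operations defined later
    add their own rules to [lin_step]. *)
Ltac lin := cbv beta; repeat first
  [ progress cbv beta | lin_eta | lin_step
  | lazymatch goal with |- bilinear_for _ _ _ => split => ? end
  | lazymatch goal with |- trilin _ => split => ? ? end].

(** * The antipode: unit, comultiplication and products *)

Section Antipode.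
Variables (k : fieldType) (H : hopfAlgType k).
Implicit Types (g h : H) (V : lmodType k).

Lemma antipode1 : antipode 1 = 1 :> H.
Proof.
have := @Sw_antipodel k H H (fun z => z) 1 (@linear_id _ _).
by rewrite Sw1 ?mulr1 ?counit1 ?scale1r //; lin.
Qed.

(* [\sum (1 ⊗ h_(1)) Δ(S h_(2)) = S h ⊗ 1] *)
Lemma Sw_comul_antipode V (F : H -> H -> V) h : bilin F ->
  Sw h (fun x y => Sw (antipode y) (fun u v => F u (x * v))) = F (antipode h) 1.
Proof.
move=> [F1 F2].
have lF (U : lmodType k) (f : U -> H) v : linear f -> linear (fun x => F (f x) v).
  by move=> lf; apply: (linear_comp (F1 v) lf).
have lF' (U : lmodType k) (f : U -> H) v : linear f -> linear (fun x => F v (f x)).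
  by move=> lf; apply: (linear_comp (F2 v) lf).
(* [K] is summed over four legs [x], [p1], [p2], [q] of [h]. Collapsing [p * antipode q] to a counit
   gives the right side; collapsing [antipode x * p1] gives the left side. *)
pose K q x p1 p2 := Sw (antipode q) (fun u v => F (antipode x * (p1 * u)) (p2 * v)).
have K3 q : trilin (K q).
  by rewrite /K; lin.
transitivity (Sw h (fun x y => Sw y (fun p q => Sw p (K q x)))); last first.
  rewrite -(Sw_counitr (f := fun x => F (antipode x) 1)); last by apply: lF; lin.
  apply: eq_Sw => x y; rewrite -[antipode x]mulr1.
  have b : bilin (fun u v => F (antipode x * u) v).
    by split=> u; [apply: lF|apply: lF']; lin.
  rewrite -[F _ 1](Sw1 b) -(Sw_antipoder (f := fun z => Sw z _)); last by lin.
  apply: eq_Sw => p q; rewrite SwM //.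
rewrite -SwA; last by rewrite /K; lin.
apply: eq_Sw => x q; rewrite -SwA //.
rewrite -(Sw_counitl (f := fun z => Sw (antipode q) (fun u v => F u (z * v)))); last by lin.
apply: eq_Sw => y p2.
transitivity ((counit y : k) *: Sw (antipode q) (fun u v => F (1 * u) (p2 * v))).
  by congr (_ *: _); apply: eq_Sw => u v; rewrite mul1r.
rewrite -(Sw_antipodel (f := fun z => Sw (antipode q) (fun u v => F (z * u) (p2 * v)))).
  2: by lin.
by apply: eq_Sw => a b; apply: eq_Sw => u v; rewrite mulrA.
Qed.

(** Both sides are convolution inverses of the multiplication. The sum of [G] over three legs of [g]
    and three of [h] is evaluated twice: the factor [(y1 * b1) * antipode (y2 * b2)] collapses to
    counits, and so does [antipode a * antipode x * y1 * b1]. *)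
Lemma antipodeM g h : antipode (g * h) = antipode h * antipode g.
Proof.
pose G x y1 y2 a b1 b2 : H :=
  antipode a * antipode x * ((y1 * b1) * antipode (y2 * b2)).
transitivity (Sw g (fun x y => Sw h (fun a b =>
    (counit y : k) *: ((counit b : k) *: (antipode a * antipode x : H))))); last first.
  rewrite -[RHS](Sw_counitr (f := fun x => antipode h * antipode x)); last by lin.
  apply: eq_Sw => x y; rewrite -Sw_map; last by lin.
  by rewrite (Sw_counitr (f := fun a => antipode a * _)) //; lin.
transitivity (Sw g (fun x y => Sw y (fun y1 y2 => Sw h (fun a b => Sw b (fun b1 b2 =>
    G x y1 y2 a b1 b2))))); last first.
  apply: eq_Sw => x y; rewrite Sw_exchange; apply: eq_Sw => a b.
  rewrite scalerA -counitM -[antipode a * antipode x in RHS]mulr1.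
  rewrite -(Sw_antipoder (f := fun z => antipode a * antipode x * z)); last by lin.
  by rewrite SwM //; lin.
rewrite -SwA; last by rewrite /G; lin.
transitivity (Sw g (fun x' y2 => Sw h (fun a' b2 =>
    (counit x' : k) *: ((counit a' : k) *: (antipode (y2 * b2) : H))))).
  rewrite -[LHS](Sw_counitl (f := fun y => antipode (y * h))); last by lin.
  apply: eq_Sw => x y; rewrite -Sw_map; last by lin.
  by rewrite (Sw_counitl (f := fun b => antipode (y * b))) //; lin.
apply: eq_Sw => x' y2.
transitivity (Sw x' (fun x y1 => Sw h (fun a' b2 => Sw a' (fun a b1 =>
    G x y1 y2 a b1 b2)))); last first.
  by apply: eq_Sw => x y1; rewrite SwA //; rewrite /G; lin.
rewrite Sw_exchange; apply: eq_Sw => a' b2; rewrite Sw_exchange.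
transitivity (Sw a' (fun a b1 =>
    (counit x' : k) *: (antipode a * (1 * (b1 * antipode (y2 * b2))) : H))).
  rewrite -Sw_map; last by lin.
  rewrite -[antipode (y2 * b2) in LHS]mul1r.
  rewrite -(Sw_antipodel (f := fun z => z * antipode (y2 * b2))); last by lin.
  by congr (_ *: _); apply: eq_Sw => a b1; rewrite mul1r mulrA.
apply: eq_Sw => a b1.
rewrite -(Sw_antipodel (f := fun z => antipode a * (z * (b1 * antipode (y2 * b2))))); last by lin.
by apply: eq_Sw => x y1; rewrite /G !mulrA.
Qed.

End Antipode.

(** * The partial action on [H ⊗ A] *)

Section TensorOps.
Variables (k : fieldType) (H : hopfAlgType k) (A : nuAlgType k).
Variable act : {linear (H ⊗ A)%type -> A}.
Local Notation "h ▷ a" := (act (h ⊗ a)) (at level 40, left associativity).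
Local Notation X := (H ⊗ A)%type.
Implicit Types (g h : H) (a b c : A) (x : X).

Definition diag_act h x : X :=
  tlift (fun g a => Sw h (fun h1 h2 => (h1 * g) ⊗ (h2 ▷ a))) x.
Definition rmul x b : X := tlift (fun g a => g ⊗ (a ∙ b)) x.
Definition absorb a x : X := tlift (fun g b => Sw g (fun g1 g2 => g1 ⊗ (g2 ▷ a ∙ b))) x.
Definition slice (xi : H -> k^o) x : A := tlift (fun g a => (xi g : k) *: a) x.

Fact diag_act_bilin h : bilin (fun g a => Sw h (fun h1 h2 => (h1 * g) ⊗ (h2 ▷ a))).
Proof. by lin. Qed.

Fact rmul_bilin b : bilin (fun (g : H) a => g ⊗ (a ∙ b)).
Proof. by lin. Qed.

Fact absorb_bilin a : bilin (fun g b => Sw g (fun g1 g2 => g1 ⊗ (g2 ▷ a ∙ b))).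
Proof. by lin. Qed.

Fact slice_bilin (xi : H -> k^o) : linear xi -> bilin (fun g a => (xi g : k) *: a : A).
Proof. by move=> lxi; lin. Qed.

Lemma diag_act_tens h g a :
  diag_act h (g ⊗ a) = Sw h (fun h1 h2 => (h1 * g) ⊗ (h2 ▷ a)).
Proof. exact: (tlift_tens _ _ (diag_act_bilin h)). Qed.

Lemma rmul_tens g a b : rmul (g ⊗ a) b = g ⊗ (a ∙ b).
Proof. exact: (tlift_tens _ _ (rmul_bilin b)). Qed.

Lemma absorb_tens a g b : absorb a (g ⊗ b) = Sw g (fun g1 g2 => g1 ⊗ (g2 ▷ a ∙ b)).
Proof. exact: (tlift_tens _ _ (absorb_bilin a)). Qed.

Lemma slice_tens (xi : H -> k^o) g a : linear xi -> slice xi (g ⊗ a) = (xi g : k) *: a.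
Proof. by move=> lxi; exact: (tlift_tens _ _ (slice_bilin lxi)). Qed.

Section Linear.
Variable U : lmodType k.

Lemma linear_diag_actr h (f : U -> X) : linear f -> linear (fun u => diag_act h (f u)).
Proof. exact: (linear_tlift (diag_act_bilin h)). Qed.

Lemma linear_rmull b (f : U -> X) : linear f -> linear (fun u => rmul (f u) b).
Proof. exact: (linear_tlift (rmul_bilin b)). Qed.

Lemma linear_absorb a (f : U -> X) : linear f -> linear (fun u => absorb a (f u)).
Proof. exact: (linear_tlift (absorb_bilin a)). Qed.

Lemma linear_slice (xi : H -> k^o) (f : U -> X) :
  linear xi -> linear f -> linear (fun u => slice xi (f u)).
Proof. by move=> lxi; exact: (linear_tlift (slice_bilin lxi)). Qed.

Lemma linear_diag_actl x (f : U -> H) : linear f -> linear (fun u => diag_act (f u) x).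
Proof.
move=> lf; have [s ->] := tensP x.
apply: eq_linear => [u|]; first exact: (linear_fun_sum (tlift_is_linear (diag_act_bilin _))).
apply: linear_bigsum => p; apply: eq_linear => [u|]; first exact: diag_act_tens.
by lin.
Qed.

Lemma linear_rmulr x (f : U -> A) : linear f -> linear (fun u => rmul x (f u)).
Proof.
move=> lf; have [s ->] := tensP x.
apply: eq_linear => [u|].
  exact: (linear_fun_sum (tlift_is_linear (rmul_bilin _))).
apply: linear_bigsum => p; apply: eq_linear => [u|]; first exact: rmul_tens.
by lin.
Qed.

Lemma linear_slicel x (xi : U -> H -> k^o) :
    (forall u, linear (xi u)) -> (forall g, linear (fun u => xi u g)) ->
  linear (fun u => slice (xi u) x).
Proof.
move=> lxi lxi'; have [s ->] := tensP x.
apply: eq_linear => [u|].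
  exact: (linear_fun_sum (tlift_is_linear (slice_bilin (lxi u)))).
apply: linear_bigsum => p; apply: eq_linear => [u|]; first exact: (slice_tens _ _ (lxi u)).
exact: linear_scalel.
Qed.

End Linear.

End TensorOps.
Arguments rmul {k H A} x b.

Ltac lin_tensor := lazymatch goal with |- GRing.linear_for _ ?F => match F with
  | (fun u => diag_act _ ?h (@?f u)) => refine (@linear_diag_actr _ _ _ _ _ h f _)
  | (fun u => diag_act _ (@?f u) ?y) => refine (@linear_diag_actl _ _ _ _ _ y f _)
  | (fun u => rmul (@?f u) ?b) => refine (@linear_rmull _ _ _ _ b f _)
  | (fun u => rmul ?y (@?f u)) => refine (@linear_rmulr _ _ _ _ y f _)
  | (fun u => absorb _ ?a (@?f u)) => refine (@linear_absorb _ _ _ _ _ a f _)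
  | (fun u => slice ?xi (@?f u)) => refine (@linear_slice _ _ _ _ xi f _ _)
  | (fun u => slice (@?xi u) ?y) => refine (@linear_slicel _ _ _ _ y xi _ _) => ?
  end end.
Ltac lin_step ::= first [ lin_tensor | lin_base | eassumption | lin_hyp ].

(** * Compatibility of the operators on [H ⊗ A] with the action *)

Section PartialAction.
Variables (k : fieldType) (H : hopfAlgType k) (A : nuAlgType k).
Variable act : {linear (H ⊗ A)%type -> A}.
Local Notation "h ▷ a" := (act (h ⊗ a)) (at level 40, left associativity).
Local Notation X := (H ⊗ A)%type.
Local Notation diag_act := (diag_act act).
Local Notation absorb := (absorb act).
Implicit Types (g h : H) (a b c : A) (x : X).

Lemma actZ h (s : k) a : h ▷ (s *: a) = s *: (h ▷ a).
Proof. by apply: (linear_funZ (f := fun a => h ▷ a)); lin. Qed.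

Lemma rmulA x b c : rmul (rmul x b) c = rmul x (b ∙ c).
Proof.
move: x; apply: tensor_ext => [||h a]; [by lin|by lin|].
by rewrite !rmul_tens numulA.
Qed.

Lemma slice_rmul (xi : H -> k^o) x b : linear xi -> slice xi (rmul x b) = slice xi x ∙ b.
Proof.
move=> lxi; move: x; apply: tensor_ext => [||h a]; [by lin|by lin|].
rewrite rmul_tens !slice_tens //.
by rewrite (linear_funZ _ (numul_bilin.1 b)).
Qed.

Lemma absorb_rmul a x b : absorb a (rmul x b) = rmul (absorb a x) b.
Proof.
move: x; apply: tensor_ext => [||h c]; [by lin|by lin|].
rewrite rmul_tens !absorb_tens (Sw_map (f := rmul^~ b)); last by lin.
by apply: eq_Sw => h1 h2; rewrite rmul_tens numulA.
Qed.

(** By [slice_vanish], [x] may be treated as an element of [H ⊗ r(A)]; on [g ⊗ b] with [b] in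
    [r(A)], every product [(g2 ▷ a) ∙ b] in the absorption is zero. *)
Lemma absorb_eq0 a x :
    (forall (xi : H -> k^o), linear xi -> right_annihilator (slice xi x)) ->
  absorb a x = 0.
Proof.
have [s ->] := tensP x => sx.
rewrite (linear_fun_sum (f := absorb a)); last by lin.
under eq_bigr => p _ do rewrite absorb_tens.
apply: (slice_vanish (J := @right_annihilator k A) (absorb_bilin act a))
  => [b|c u v u0 v0 b|g b rb|xi lxi].
- by rewrite (linear_fun0 (numul_bilin.2 b)).
- by rewrite (numul_bilin.2 b) u0 v0 /= scaler0 addr0 //.
- rewrite /Sw big1 // => p _.
  by rewrite rb (linear_fun0 ((tens_bilin H A).2 _)).
have := sx xi lxi.
rewrite (linear_fun_sum (f := slice xi)); last by lin.
by under eq_bigr => p _ do rewrite slice_tens //.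
Qed.

Hypothesis act_sym : symmetrical_partial_action act.

Lemma act1 a : 1 ▷ a = a. Proof. exact: act_sym.1.1. Qed.

Lemma act_mul h g a b :
  h ▷ (a ∙ (g ▷ b)) = Sw h (fun h1 h2 => (h1 ▷ a) ∙ ((h2 * g) ▷ b)).
Proof. by rewrite act_sym.1.2 tlift_comul //; lin. Qed.

Lemma act_mull h g a b :
  h ▷ ((g ▷ b) ∙ a) = Sw h (fun h1 h2 => ((h1 * g) ▷ b) ∙ (h2 ▷ a)).
Proof. by rewrite act_sym.2 tlift_comul //; lin. Qed.

Lemma diag_act1 x : diag_act 1 x = x.
Proof.
move: x; apply: tensor_ext => [||h a]; [by lin|by lin|].
by rewrite diag_act_tens Sw1 ?mul1r ?act1 //; lin.
Qed.

(** This is [act_mul] in the second tensor factor, regrouped by coassociativity. It yields the rule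
    for the action on [N] and right multiplication by [A]. *)
Lemma diag_act_rmul h g x b :
  diag_act h (rmul x (g ▷ b)) =
  Sw h (fun h1 h2 => rmul (diag_act h1 x) ((h2 * g) ▷ b)).
Proof.
move: x; apply: tensor_ext => [||u a]; [by lin|by lin|].
rewrite rmul_tens diag_act_tens.
transitivity (Sw h (fun h1 h2 => Sw h2 (fun h3 h4 =>
    (h1 * u) ⊗ ((h3 ▷ a) ∙ ((h4 * g) ▷ b))))).
  by apply: eq_Sw => h1 h2; rewrite act_mul Sw_map //; lin.
rewrite -SwA; last by lin.
apply: eq_Sw => h1 h2; rewrite diag_act_tens (Sw_map (f := rmul^~ _)); last by lin.
by apply: eq_Sw => h3 h4; rewrite rmul_tens.
Qed.

(** Symmetry of the action enters here: [act_mull] turns [h ▷ ((g2 ▷ a) ∙ b)] into products of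
    [(h1 * g2) ▷ a] and [h2 ▷ b], and the legs of [h] and [g] recombine into those of a product. *)
Lemma diag_act_absorb h a x : diag_act h (absorb a x) = absorb a (diag_act h x).
Proof.
move: x; apply: tensor_ext => [||g b]; [by lin|by lin|].
rewrite absorb_tens diag_act_tens.
rewrite (Sw_map (f := diag_act h)); last by lin.
rewrite (Sw_map (f := absorb a)); last by lin.
transitivity (Sw h (fun h1 h2 => Sw h2 (fun h3 h4 => Sw g (fun g1 g2 =>
    (h1 * g1) ⊗ (((h3 * g2) ▷ a) ∙ (h4 ▷ b)))))).
  transitivity (Sw g (fun g1 g2 => Sw h (fun h1 h2 => Sw h2 (fun h3 h4 =>
      (h1 * g1) ⊗ (((h3 * g2) ▷ a) ∙ (h4 ▷ b)))))).
    apply: eq_Sw => g1 g2; rewrite diag_act_tens; apply: eq_Sw => h1 h2.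
    by rewrite act_mull Sw_map //; lin.
  by rewrite Sw_exchange; apply: eq_Sw => h1 h2; exact: Sw_exchange.
rewrite -SwA; last by lin.
apply: eq_Sw => h1 h2; rewrite absorb_tens SwM //.
by lin.
Qed.

(** After [act_mul] splits [h1], [Sw_comul_antipode] cancels everything that acts on the [A]-factor
    of [x], so only [xi] gets twisted. This keeps the span [M] stable under [H]. *)
Lemma act_slice_antipode h a (xi : H -> k^o) x : linear xi ->
  Sw h (fun h1 h2 => h1 ▷ (a ∙ slice xi (diag_act (antipode h2) x))) =
  Sw h (fun h1 h2 => (h1 ▷ a) ∙ slice (fun g => xi (antipode h2 * g)) x).
Proof.
move=> lxi.
have lxi' (U : lmodType k) (f : U -> H) : linear f -> linear (fun u => xi (f u)).
  exact: linear_comp.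
move: x; apply: tensor_ext => [||g b]; [by lin|by lin|].
transitivity (Sw h (fun h1 h2 => Sw h1 (fun p q => Sw (antipode h2) (fun u v =>
    (xi (u * g) : k) *: ((p ▷ a) ∙ ((q * v) ▷ b)))))).
  apply: eq_Sw => h1 h2; rewrite diag_act_tens Sw_exchange.
  rewrite (Sw_map (f := fun x => h1 ▷ (a ∙ slice xi x))); last by lin.
  apply: eq_Sw => u v; rewrite slice_tens // -Sw_map; last by lin.
  by rewrite (linear_funZ _ (numul_bilin.2 a)) actZ act_mul.
rewrite SwA; last by lin.
apply: eq_Sw => p y.
rewrite (Sw_comul_antipode (F := fun u v => (xi (u * g) : k) *: ((p ▷ a) ∙ (v ▷ b)))).
  2: by lin.
rewrite act1 slice_tens; last by lin.
by rewrite (linear_funZ _ (numul_bilin.2 _)).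
Qed.

(** The right side is the expanded form of the action of [h1] on the map [a ∙ slice xi], evaluated
    at [h2 * g] acting on [x]; this gives [act_app] below. *)
Lemma act_slice h g a (xi : H -> k^o) x : linear xi ->
  h ▷ (a ∙ slice xi (diag_act g x)) =
  Sw h (fun h1 h2 => Sw h1 (fun h3 h4 =>
    (h3 ▷ a) ∙ slice (fun g => xi (antipode h4 * g)) (diag_act (h2 * g) x))).
Proof.
move=> lxi.
have lxi' (U : lmodType k) (f : U -> H) : linear f -> linear (fun u => xi (f u)).
  exact: linear_comp.
move: x; apply: tensor_ext => [||u b]; [by lin|by lin|].
rewrite diag_act_tens (Sw_map (f := fun x => h ▷ (a ∙ slice xi x))); last by lin.
transitivity (Sw h (fun h3 y => Sw g (fun r d =>
    (xi (r * u) : k) *: ((h3 ▷ a) ∙ ((y * d) ▷ b))))).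
  rewrite Sw_exchange; apply: eq_Sw => r d; rewrite slice_tens //.
  rewrite (linear_funZ _ (numul_bilin.2 a)) actZ act_mul.
  by rewrite Sw_map //; lin.
transitivity (Sw h (fun h1 h2 => Sw h1 (fun h3 h4 => Sw h2 (fun p q => Sw g (fun r d =>
    (xi (antipode h4 * p * (r * u)) : k) *: ((h3 ▷ a) ∙ ((q * d) ▷ b))))))).
  rewrite SwA; last by lin.
  apply: eq_Sw => h3 y; rewrite -SwA; last by lin.
  pose K z q := Sw g (fun r d => (xi (z * (r * u)) : k) *: ((h3 ▷ a) ∙ ((q * d) ▷ b))).
  (* A factor 1 is inserted inside [xi] and rewritten as [antipode h4 * p] on two new legs of
     [h]. *)
  transitivity (Sw y (fun z q => (counit z : k) *: K 1 q)).
    rewrite (Sw_counitl (f := K 1)); last by rewrite /K; lin.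
    by apply: eq_Sw => r d; rewrite mul1r.
  apply: eq_Sw => z q; rewrite -(Sw_antipodel (f := K^~ q)) //.
  by rewrite /K; lin.
apply: eq_Sw => h1 h2; apply: eq_Sw => h3 h4.
rewrite diag_act_tens SwM; last by lin.
rewrite (Sw_map (f := fun x => (h3 ▷ a) ∙ slice _ x)); last by lin.
apply: eq_Sw => p q.
rewrite (Sw_map (f := fun x => (h3 ▷ a) ∙ slice _ x)); last by lin.
apply: eq_Sw => r d; rewrite slice_tens; last by lin.
by rewrite (linear_funZ _ (numul_bilin.2 _)) /= !mulrA.
Qed.

End PartialAction.

(** * The Morita context *)

Section Modules.
Variables (k : fieldType) (H : hopfAlgType k) (A : nuAlgType k).
Variable act : {linear (H ⊗ A)%type -> A}.
Local Notation X := (H ⊗ A)%type.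

(* [n l] is the coefficient of the word [l], whose head is the letter absorbed first;
   quantifying over all large [L'] makes sense of the finite sum over the letters. *)
Definition coherent (n : seq A -> X) := forall l, exists L : seq A,
  forall L', uniq L' -> {subset L <= L'} -> n l = \sum_(a <- L') absorb act a (n (a :: l)).

Definition N_gen (n : seq A -> X) :=
  exists m b, coherent m /\ n = (fun l => rmul (m l) b).
Definition Nmod := lsub N_gen.
HB.instance Definition _ := GRing.Lmodule.on Nmod.

Definition M_gen (m : Nmod -> A) := exists a l (xi : H -> k^o),
  linear xi /\ m = (fun n => a ∙ slice xi (lsub_val n l)).
Definition Mmod := lsub M_gen.
HB.instance Definition _ := GRing.Lmodule.on Mmod.

Lemma coherent_lin c m n : coherent m -> coherent n -> coherent (c *: m + n).
Proof.
(* Either sum may be taken over any larger duplicate-free list, so the concatenation serves both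
   families. *)
move=> cm cn l; have [L1 mL] := cm l; have [L2 nL] := cn l.
exists (L1 ++ L2) => L' uL' sL.
rewrite /= (_ : (c *: m + n) l = c *: m l + n l) //.
rewrite (mL L') //; last by move=> a aL; apply: sL; rewrite mem_cat aL.
rewrite (nL L') //; last by move=> a aL; apply: sL; rewrite mem_cat aL orbT.
rewrite scaler_sumr -big_split; apply: eq_bigr => a _ /=.
by rewrite (linear_absorb act a (@linear_id _ _)).
Qed.

Lemma coherent0 : coherent 0.
Proof.
move=> l; exists [::] => L' _ _; rewrite big1 // => a _.
by apply: (linear_fun0 (f := absorb act a)); exact: linear_absorb.
Qed.

Lemma coherent_map (f : X -> X) m : linear f ->
    (forall a x, f (absorb act a x) = absorb act a (f x)) ->
  coherent m -> coherent (fun l => f (m l)).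
Proof.
move=> lf fa cm l; have [L mL] := cm l; exists L => L' uL' sL.
by rewrite (mL L') // (linear_fun_sum lf); apply: eq_bigr.
Qed.

Lemma coherent_rmul m b : coherent m -> coherent (fun l => rmul (m l) b).
Proof.
move=> cm; apply: (coherent_map (f := rmul^~ b) _ _ cm) => [|a x].
  exact: linear_rmull.
by rewrite absorb_rmul.
Qed.

Lemma Nmod_coherent (n : Nmod) : coherent (lsub_val n).
Proof.
elim: (lsubP n) => [_ [m [b [cm ->]]]||c u v _ cu _ cv].
- exact: coherent_rmul.
- exact: coherent0.
- exact: coherent_lin.
Qed.

Lemma coherent_N m b : coherent m -> lspan N_gen (fun l => rmul (m l) b).
Proof. by move=> cm; apply: lspan_gen; exists m, b. Qed.

Fact N_rmul_subproof (n : Nmod) b : lspan N_gen (fun l => rmul (lsub_val n l) b).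
Proof. exact/coherent_N/Nmod_coherent. Qed.
Definition N_rmul n b : Nmod := in_lsub (N_rmul_subproof n b).

Lemma N_ext (n n' : Nmod) : (forall l, lsub_val n l = lsub_val n' l) -> n = n'.
Proof. by move=> nn'; apply/lsub_inj/funext. Qed.

Lemma M_ext (m m' : Mmod) : (forall n, lsub_val m n = lsub_val m' n) -> m = m'.
Proof. by move=> mm'; apply/lsub_inj/funext. Qed.

Lemma N_rmulA n a b : N_rmul (N_rmul n a) b = N_rmul n (a ∙ b).
Proof. by apply: N_ext => l /=; rewrite rmulA. Qed.

Lemma Mmod_linear (m : Mmod) : linear (lsub_val m).
Proof.
elim: (lsubP m) => [_ [a [l [xi [lxi ->]]]]||c u v _ lu _ lv].
- by apply: linear_numulr; apply: (linear_slice lxi (f := fun n : Nmod => lsub_val n l)).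
- by move=> c x y; rewrite /= scaler0 addr0.
move=> d x y; rewrite /= (_ : (c *: u + v) _ = c *: u (d *: x + y) + v (d *: x + y)) //.
by rewrite lu lv !scalerDr !scalerA (mulrC c) addrACA.
Qed.

Lemma Mmod_rmul (m : Mmod) n b : lsub_val m (N_rmul n b) = lsub_val m n ∙ b.
Proof.
elim: (lsubP m) => [_ [a [l [xi [lxi ->]]]]||c u v _ eu _ ev] /=.
- by rewrite slice_rmul // numulA.
- by rewrite (linear_fun0 (numul_bilin.1 b)).
by rewrite (_ : (c *: u + v) _ = c *: u (N_rmul n b) + v (N_rmul n b)) // eu ev
  (_ : (c *: u + v) _ = c *: u n + v n) // (numul_bilin.1 b).
Qed.

Fact M_lact_subproof a (m : Mmod) : lspan M_gen (fun n => a ∙ lsub_val m n).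
Proof.
apply: (lspan_map (f := fun m n => a ∙ m n) _ _ (lsubP m)).
  by move=> c u v; apply/funext => n; rewrite [LHS](numul_bilin.2 a).
move=> _ [b [l [xi [lxi ->]]]]; apply: lspan_gen; exists (a ∙ b), l, xi; split=> //.
by apply/funext => n; rewrite numulA.
Qed.
Definition M_lact a m : Mmod := in_lsub (M_lact_subproof a m).

Definition B_gen (b : Nmod -> Nmod) :=
  exists n (m : Mmod), b = (fun n' => N_rmul n (lsub_val m n')).
Definition Balg := lsub B_gen.
HB.instance Definition _ := GRing.Lmodule.on Balg.

Lemma linear_N_rmull (U : lmodType k) b (f : U -> Nmod) :
  linear f -> linear (fun u => N_rmul (f u) b).
Proof.
move=> lf c u v; apply: N_ext => l; rewrite /= lf.
by rewrite (linear_rmull b (@linear_id _ _)).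
Qed.

Lemma linear_N_rmulr (U : lmodType k) n (f : U -> A) :
  linear f -> linear (fun u => N_rmul n (f u)).
Proof.
move=> lf c u v; apply: N_ext => l; rewrite /= lf.
by rewrite (linear_rmulr _ (@linear_id _ _)).
Qed.

Lemma Balg_linear (b : Balg) : linear (lsub_val b).
Proof.
elim: (lsubP b) => [_ [n [m ->]]||c u v _ lu _ lv].
- by apply: linear_N_rmulr; exact: Mmod_linear.
- by move=> c x y; rewrite /= scaler0 addr0.
move=> d x y; rewrite /= (_ : (c *: u + v) _ = c *: u (d *: x + y) + v (d *: x + y)) //.
by rewrite lu lv !scalerDr !scalerA (mulrC c) addrACA.
Qed.

Lemma Balg_rmul (b : Balg) n a : lsub_val b (N_rmul n a) = N_rmul (lsub_val b n) a.
Proof.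
elim: (lsubP b) => [_ [n' [m ->]]||c u v _ eu _ ev] /=.
- by rewrite Mmod_rmul N_rmulA.
- by rewrite (linear_fun0 (linear_N_rmull a (@linear_id _ _))).
by rewrite (_ : (c *: u + v) _ = c *: u (N_rmul n a) + v (N_rmul n a)) // eu ev
  (_ : (c *: u + v) _ = c *: u n + v n) // (linear_N_rmull a (@linear_id _ _)).
Qed.

Fact M_ract_subproof (m : Mmod) (b : Balg) :
  lspan M_gen (fun n => lsub_val m (lsub_val b n)).
Proof.
apply: (lspan_map (f := fun b n => lsub_val m (b n)) _ _ (lsubP b)).
  by move=> c u v; apply/funext => n; rewrite [LHS]Mmod_linear.
move=> _ [n [m' ->]].
(* By right [A]-linearity, [m] composed with the operator [n m'(-)] is [m(n) m'(-)]. *)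
rewrite (_ : (fun _ => _) = lsub_val (M_lact (lsub_val m n) m')); first exact: lsubP.
by apply/funext => n'; rewrite Mmod_rmul.
Qed.
Definition M_ract m b : Mmod := in_lsub (M_ract_subproof m b).

Definition rank1 n m : Balg := in_lsub (lspan_gen (ex_intro _ n (ex_intro _ m erefl))).

Fact B_mul_subproof (b b' : Balg) : lspan B_gen (fun n => lsub_val b (lsub_val b' n)).
Proof.
apply: (lspan_map (f := fun b n => b (lsub_val b' n)) _ _ (lsubP b)) => //.
(* Precomposing a rank-one operator only changes its functional. *)
move=> _ [n [m ->]]; exact: (lsubP (rank1 n (M_ract m b'))).
Qed.
Definition B_mul b b' : Balg := in_lsub (B_mul_subproof b b').

Lemma B_ext (b b' : Balg) : (forall n, lsub_val b n = lsub_val b' n) -> b = b'.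
Proof. by move=> bb'; apply/lsub_inj/funext. Qed.

Fact B_mulA : associative B_mul. Proof. by move=> a b c; apply: B_ext. Qed.

Fact B_mul_bilin : bilin B_mul.
Proof.
split=> b c u v; apply: B_ext => n //=.
by rewrite [LHS]Balg_linear.
Qed.
HB.instance Definition _ := Lmodule_isNuAlgebra.Build k Balg B_mulA B_mul_bilin.

End Modules.

Section SweedlerFunctions.
Variables (k : fieldType) (H : hopfAlgType k).
Implicit Type h : H.

Lemma fun_SwE (T : Type) (V : lmodType k) h (F : H -> H -> T -> V) t :
  Sw h F t = Sw h (fun h1 h2 => F h1 h2 t).
Proof. by rewrite /Sw fct_sumE. Qed.

Lemma lsub_Sw (V : lmodType k) (S : V -> Prop) h (F : H -> H -> lsub S) :
  lsub_val (Sw h F) = Sw h (fun h1 h2 => lsub_val (F h1 h2)).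
Proof. exact: lsub_sum. Qed.

Lemma lspan_Sw (V : lmodType k) (S : V -> Prop) h (F : H -> H -> V) :
  (forall h1 h2, lspan S (F h1 h2)) -> lspan S (Sw h F).
Proof. by move=> SF; apply: lspan_sum => p _. Qed.

End SweedlerFunctions.

(** * The action of [H] on [N], and linearity of the module operations *)

Section ActionN.
Variables (k : fieldType) (H : hopfAlgType k) (A : nuAlgType k).
Variable act : {linear (H ⊗ A)%type -> A}.
Hypothesis act_sym : symmetrical_partial_action act.
Local Notation "h ▷ a" := (act (h ⊗ a)) (at level 40, left associativity).
Local Notation N := (Nmod act).
Local Notation M := (Mmod act).
Local Notation B := (Balg act).
Implicit Types (g h : H) (a : A).

(** On a generator [m b] the result is the sum of the [(h1 m)(h2 ▷ b)], and each [h1 m] is again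
    coherent because absorption is equivariant. *)
Fact N_act_subproof h (n : N) :
  lspan (@N_gen k H A act) (fun l => diag_act act h (lsub_val n l)).
Proof.
apply: (lspan_map (f := fun n l => diag_act act h (n l)) _ _ (lsubP n)).
  move=> c u v; apply/funext => l.
  exact: (linear_diag_actr act h (@linear_id _ _)).
move=> _ [m [b [cm ->]]].
rewrite (_ : (fun _ => _) =
    Sw h (fun h1 h2 l => rmul (diag_act act h1 (m l)) (h2 ▷ b))).
  apply: lspan_Sw => h1 h2.
  apply: (coherent_N (m := fun l => diag_act act h1 (m l))).
  apply: (coherent_map (f := diag_act act h1) _ _ cm) => [|a x].
    exact: linear_diag_actr.
  exact: diag_act_absorb.
(* Reading [b] as [1 ▷ b] brings it into the form that [diag_act_rmul] accepts. *)
apply/funext => l; rewrite fun_SwE -{1}[b](act1 act_sym) (diag_act_rmul act_sym).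
by apply: eq_Sw => h1 h2; rewrite mulr1.
Qed.
Definition N_act h (n : N) : N := in_lsub (N_act_subproof h n).

Lemma linear_N_actr (U : lmodType k) h (f : U -> N) :
  linear f -> linear (fun u => N_act h (f u)).
Proof.
move=> lf c u v; apply: N_ext => l; rewrite /= lf.
exact: (linear_diag_actr act h (@linear_id _ _)).
Qed.

Lemma linear_N_actl (U : lmodType k) n (f : U -> H) :
  linear f -> linear (fun u => N_act (f u) n).
Proof.
move=> lf c u v; apply: N_ext => l; rewrite /= lf.
exact: (linear_diag_actl act _ (@linear_id _ _)).
Qed.

Lemma linear_lsub (U V : lmodType k) (T : Type) (S : (T -> V) -> Prop)
  (t : T) (f : U -> lsub S) : linear f -> linear (fun u => lsub_val (f u) t).
Proof. by move=> lf c u v; rewrite lf. Qed.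

Lemma linear_M_app (U : lmodType k) (m : M) (f : U -> N) :
  linear f -> linear (fun u => lsub_val m (f u)).
Proof. exact: linear_comp (Mmod_linear m). Qed.

Lemma linear_B_app (U : lmodType k) (b : B) (f : U -> N) :
  linear f -> linear (fun u => lsub_val b (f u)).
Proof. exact: linear_comp (Balg_linear b). Qed.

Lemma linear_M_lactl (U : lmodType k) (m : M) (f : U -> A) :
  linear f -> linear (fun u => M_lact (f u) m).
Proof. by move=> lf c u v; apply: M_ext => n; rewrite /= lf [LHS](numul_bilin.1 _). Qed.

Lemma linear_M_lactr (U : lmodType k) a (f : U -> M) :
  linear f -> linear (fun u => M_lact a (f u)).
Proof. by move=> lf c u v; apply: M_ext => n; rewrite /= lf [LHS](numul_bilin.2 _). Qed.

Lemma linear_M_ractl (U : lmodType k) (b : B) (f : U -> M) :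
  linear f -> linear (fun u => M_ract (f u) b).
Proof. by move=> lf c u v; apply: M_ext => n; rewrite /= lf. Qed.

Lemma linear_M_ractr (U : lmodType k) (m : M) (f : U -> B) :
  linear f -> linear (fun u => M_ract m (f u)).
Proof. by move=> lf c u v; apply: M_ext => n; rewrite /= lf [LHS]Mmod_linear. Qed.

Lemma linear_rank1l (U : lmodType k) (m : M) (f : U -> N) :
  linear f -> linear (fun u => rank1 (f u) m).
Proof.
move=> lf c u v; apply: B_ext => n; rewrite /= lf.
by rewrite [LHS](linear_N_rmull (lsub_val m n) (@linear_id _ _)).
Qed.

Lemma linear_rank1r (U : lmodType k) (n : N) (f : U -> M) :
  linear f -> linear (fun u => rank1 n (f u)).
Proof.
move=> lf c u v; apply: B_ext => n'; rewrite /= lf.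
by rewrite [LHS](linear_N_rmulr n (@linear_id _ _)).
Qed.

End ActionN.

Ltac lin_mod := lazymatch goal with |- GRing.linear_for _ ?F => match F with
  | (fun u => N_act _ ?h (@?f u)) => refine (@linear_N_actr _ _ _ _ _ _ h f _)
  | (fun u => N_act _ (@?f u) ?n) => refine (@linear_N_actl _ _ _ _ _ _ n f _)
  | (fun u => N_rmul (@?f u) ?b) => refine (@linear_N_rmull _ _ _ _ _ b f _)
  | (fun u => N_rmul ?n (@?f u)) => refine (@linear_N_rmulr _ _ _ _ _ n f _)
  | (fun u => M_lact (@?f u) ?m) => refine (@linear_M_lactl _ _ _ _ _ m f _)
  | (fun u => M_lact ?a (@?f u)) => refine (@linear_M_lactr _ _ _ _ _ a f _)
  | (fun u => M_ract (@?f u) ?b) => refine (@linear_M_ractl _ _ _ _ _ b f _)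
  | (fun u => M_ract ?m (@?f u)) => refine (@linear_M_ractr _ _ _ _ _ m f _)
  | (fun u => B_mul (@?f u) ?b) => refine (@linear_numull _ _ (Balg _) f b _)
  | (fun u => B_mul ?b (@?f u)) => refine (@linear_numulr _ _ (Balg _) f b _)
  | (fun u => rank1 (@?f u) ?m) => refine (@linear_rank1l _ _ _ _ _ m f _)
  | (fun u => rank1 ?n (@?f u)) => refine (@linear_rank1r _ _ _ _ _ n f _)
  | (fun u => lsub_val (@?f u) ?t) => refine (@linear_lsub _ _ _ _ _ t f _)
  | (fun u => lsub_val ?m (@?f u)) => refine (@linear_M_app _ _ _ _ _ m f _)
  | (fun u => lsub_val ?m (@?f u)) => refine (@linear_B_app _ _ _ _ _ m f _)
  end end.
Ltac lin_step ::= first [ lin_mod | lin_tensor | lin_base | eassumption | lin_hyp ].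

(** * The action of [H] on [M] *)

Section ActionM.
Variables (k : fieldType) (H : hopfAlgType k) (A : nuAlgType k).
Variable act : {linear (H ⊗ A)%type -> A}.
Hypothesis act_sym : symmetrical_partial_action act.
Local Notation "h ▷ a" := (act (h ⊗ a)) (at level 40, left associativity).
Local Notation N := (Nmod act).
Local Notation M := (Mmod act).
Local Notation B := (Balg act).
Local Notation N_act := (N_act act_sym).
Implicit Types (g h : H) (a : A).

Lemma N_act1 n : N_act 1 n = n.
Proof. by apply: N_ext => l; rewrite /= (diag_act1 act_sym). Qed.

Lemma N_act_rmul h g n b :
  N_act h (N_rmul n (g ▷ b)) =
  Sw h (fun h1 h2 => N_rmul (N_act h1 n) ((h2 * g) ▷ b)).
Proof.
by apply: N_ext => l; rewrite /= (diag_act_rmul act_sym) lsub_Sw fun_SwE.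
Qed.

Lemma N_act_rmul1 h n b :
  N_act h (N_rmul n b) = Sw h (fun h1 h2 => N_rmul (N_act h1 n) (h2 ▷ b)).
Proof.
rewrite -{1}[b](act1 act_sym) N_act_rmul.
by apply: eq_Sw => h1 h2; rewrite mulr1.
Qed.

(** The usual Hopf action on a space of maps. It is defined on all functions first, since stability
    of [M] is known only after a computation on generators. *)
Definition M_act_fun h (m : N -> A) (n : N) : A :=
  Sw h (fun h1 h2 => h1 ▷ m (N_act (antipode h2) n)).

Lemma M_act_fun_gen h a l (xi : H -> k^o) : linear xi ->
  M_act_fun h (fun n => a ∙ slice xi (lsub_val n l)) =
  Sw h (fun h1 h2 n => (h1 ▷ a) ∙ slice (fun g => xi (antipode h2 * g)) (lsub_val n l)).
Proof.
by move=> lxi; apply/funext => n; rewrite fun_SwE -(act_slice_antipode act_sym).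
Qed.

Lemma M_act_fun_linear h : linear (M_act_fun h).
Proof.
move=> c u v; apply/funext => n; rewrite [RHS]/GRing.add /= [in RHS]/GRing.scale /=.
rewrite /M_act_fun /Sw scaler_sumr -big_split; apply: eq_bigr => p _ /=.
have lp : linear (fun x => p.1 ▷ x) by lin.
exact: lp.
Qed.

Fact M_act_subproof h (m : M) : lspan (@M_gen k H A act) (M_act_fun h (lsub_val m)).
Proof.
apply: (lspan_map (M_act_fun_linear h) _ (lsubP m)).
move=> _ [a [l [xi [lxi ->]]]]; rewrite M_act_fun_gen //.
apply: lspan_Sw => h1 h2; apply: lspan_gen.
exists (h1 ▷ a), l, (fun g => xi (antipode h2 * g)); split=> //.
exact/(linear_comp lxi)/linear_mulr/linear_id.
Qed.
Definition M_act h (m : M) : M := in_lsub (M_act_subproof h m).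

Lemma M_actE h m n :
  lsub_val (M_act h m) n = Sw h (fun h1 h2 => h1 ▷ lsub_val m (N_act (antipode h2) n)).
Proof. by []. Qed.

Lemma linear_M_actr (U : lmodType k) h (f : U -> M) :
  linear f -> linear (fun u => M_act h (f u)).
Proof.
move=> lf c u v; apply: M_ext => n.
have l : linear (fun m : M => Sw h (fun h1 h2 => h1 ▷ lsub_val m (N_act (antipode h2) n))).
  by lin.
by rewrite lf; exact: l.
Qed.

Lemma linear_M_actl (U : lmodType k) m (f : U -> H) :
  linear f -> linear (fun u => M_act (f u) m).
Proof.
move=> lf c u v; apply: M_ext => n.
have l : linear (fun h => Sw h (fun h1 h2 => h1 ▷ lsub_val m (N_act (antipode h2) n))).
  by lin.
by rewrite lf; exact: l.
Qed.

End ActionM.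

Ltac lin_M := lazymatch goal with |- GRing.linear_for _ ?F => match F with
  | (fun u => M_act _ ?h (@?f u)) => refine (@linear_M_actr _ _ _ _ _ _ h f _)
  | (fun u => M_act _ (@?f u) ?m) => refine (@linear_M_actl _ _ _ _ _ _ m f _)
  end end.
Ltac lin_step ::= first [ lin_M | lin_mod | lin_tensor | lin_base | eassumption | lin_hyp ].

(** * Evaluation and the actions; the action of [H] on [B] *)

Section ActionB.
Variables (k : fieldType) (H : hopfAlgType k) (A : nuAlgType k).
Variable act : {linear (H ⊗ A)%type -> A}.
Hypothesis act_sym : symmetrical_partial_action act.
Local Notation "h ▷ a" := (act (h ⊗ a)) (at level 40, left associativity).
Local Notation N := (Nmod act).
Local Notation M := (Mmod act).
Local Notation B := (Balg act).
Local Notation N_act := (N_act act_sym).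
Local Notation M_act := (M_act act_sym).
Implicit Types (g h : H) (a : A).

Lemma M_act1 m : M_act 1 m = m.
Proof.
apply: M_ext => n; rewrite M_actE Sw1; last by lin.
by rewrite antipode1 N_act1 (act1 act_sym).
Qed.

(** The generator is given as an [m] with prescribed values, so its membership proof stays out of
    later computations. *)
Lemma M_lin_eq (V : lmodType k) (f f' : M -> V) : linear f -> linear f' ->
    (forall m a l (xi : H -> k^o), linear xi ->
      (forall n, lsub_val m n = a ∙ slice xi (lsub_val n l)) -> f m = f' m) ->
  forall m, f m = f' m.
Proof.
move=> lf lf' ff'; apply: lsub_ind_span => [v Sv||c x y fx fy].
- have [a [l [xi [lxi vE]]]] := Sv.
  by apply: (ff' _ a l xi) => // n; rewrite /= vE.
- by rewrite !linear_fun0.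
by rewrite lf lf' fx fy.
Qed.

Lemma B_lin_eq (V : lmodType k) (f f' : B -> V) : linear f -> linear f' ->
  (forall n m, f (rank1 n m) = f' (rank1 n m)) -> forall b, f b = f' b.
Proof.
move=> lf lf' ff'; apply: lsub_ind_span => [v Sv||c x y fx fy].
- have [n [m vE]] := Sv.
  rewrite (_ : in_lsub _ = rank1 n m) //.
  by apply: lsub_inj; rewrite /= vE.
- by rewrite !linear_fun0.
by rewrite lf lf' fx fy.
Qed.

Lemma N_actE h n l : lsub_val (N_act h n) l = diag_act act h (lsub_val n l).
Proof. by []. Qed.

Lemma M_lactE a (m : M) n : lsub_val (M_lact a m) n = a ∙ lsub_val m n.
Proof. by []. Qed.

(** On generators this is [act_slice], with [act_slice_antipode] folding the inner sum back into
    [M_act]. It is the rule for products of [M] and [N] in the context algebra. *)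
Lemma act_app h g m n :
  h ▷ lsub_val m (N_act g n) =
  Sw h (fun h1 h2 => lsub_val (M_act h1 m) (N_act (h2 * g) n)).
Proof.
move: m; apply: M_lin_eq => [||m a l xi lxi mE]; [by lin|by lin|].
rewrite mE N_actE (act_slice act_sym) //; apply: eq_Sw => h1 h2.
rewrite M_actE -(act_slice_antipode act_sym) //.
by apply: eq_Sw => h3 h4; rewrite mE N_actE.
Qed.

(** On a generator, [act_slice_antipode] applied for [g] and then for [h] twists [xi] by
    [antipode d * antipode q]. The right side twists it by the antipode of the product [q * d],
    which agrees by [antipodeM]. *)
Lemma M_act_lact h g a m :
  M_act h (M_lact a (M_act g m)) =
  Sw h (fun h1 h2 => M_lact (h1 ▷ a) (M_act (h2 * g) m)).
Proof.
apply: M_ext => n; rewrite lsub_Sw fun_SwE; move: m.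
apply: M_lin_eq => [||m b l xi lxi mE]; [by lin|by lin|].
have lxi' (U : lmodType k) (f : U -> H) : linear f -> linear (fun u => xi (f u)).
  exact: linear_comp.
set x := lsub_val n l.
transitivity (Sw h (fun h1 h2 => Sw h2 (fun p q => Sw g (fun r d =>
    ((h1 ▷ a) ∙ ((p * r) ▷ b)) ∙ slice (fun y => xi (antipode d * (antipode q * y))) x)))).
  rewrite M_actE.
  transitivity (Sw g (fun r d => Sw h (fun h1 h2 =>
      h1 ▷ (a ∙ (r ▷ b) ∙
        slice (fun y => xi (antipode d * y)) (diag_act act (antipode h2) x))))).
    rewrite Sw_exchange; apply: eq_Sw => h1 h2; rewrite M_lactE M_actE.
    under [in LHS]eq_Sw => r d do rewrite mE N_actE N_actE.
    rewrite (act_slice_antipode act_sym) // (Sw_map (f := fun z => h1 ▷ (a ∙ z))); last by lin.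
    by apply: eq_Sw => r d; rewrite numulA.
  transitivity (Sw g (fun r d => Sw h (fun h1 h2 => Sw h1 (fun p q =>
      ((p ▷ a) ∙ ((q * r) ▷ b)) ∙ slice (fun y => xi (antipode d * (antipode h2 * y))) x)))).
    apply: eq_Sw => r d; rewrite (act_slice_antipode act_sym); last by lin.
    apply: eq_Sw => h1 h2; rewrite (act_mul act_sym).
    by rewrite (Sw_map (f := fun z => z ∙ _)) //; lin.
  rewrite Sw_exchange -SwA; last by lin.
  by apply: eq_Sw => h1 h2; exact: Sw_exchange.
apply: eq_Sw => h1 h2; rewrite M_lactE M_actE.
under [in RHS]eq_Sw => r d do rewrite mE N_actE.
rewrite (act_slice_antipode act_sym) // SwM; last by lin.
rewrite (Sw_map (f := fun z => _ ∙ z)); last by lin.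
apply: eq_Sw => p q; rewrite (Sw_map (f := fun z => _ ∙ z)); last by lin.
apply: eq_Sw => r d; rewrite numulA antipodeM.
by under [in RHS]eq_fun do rewrite -mulrA.
Qed.

(** The analogous action on operators on [N], again on all functions until stability of [B] is
    shown. *)
Definition B_act_fun h (b : N -> N) (n : N) : N :=
  Sw h (fun h1 h2 => N_act h1 (b (N_act (antipode h2) n))).

(** [N_act_rmul1] lets [h1] act separately on the vector and on the scalar; coassociativity gathers
    the latter legs into [M_act]. Hence [B] is stable. *)
Lemma B_act_fun_rank1 h n m :
  B_act_fun h (lsub_val (rank1 n m)) =
  lsub_val (Sw h (fun h1 h2 => rank1 (N_act h1 n) (M_act h2 m))).
Proof.
apply/funext => n'; rewrite lsub_Sw fun_SwE.
transitivity (Sw h (fun h1 h2 => Sw h1 (fun p q =>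
    N_rmul (N_act p n) (q ▷ lsub_val m (N_act (antipode h2) n'))))).
  by apply: eq_Sw => h1 h2; exact: N_act_rmul1.
rewrite SwA; last by lin.
apply: eq_Sw => h1 h2; rewrite [RHS]/= -[M_act_fun _ _ _ _]/(Sw _ _).
by rewrite (Sw_map (f := N_rmul _)) //; lin.
Qed.

Lemma B_act_fun_linear h : linear (B_act_fun h).
Proof.
move=> c u v; apply/funext => n; rewrite [RHS]/GRing.add /= [in RHS]/GRing.scale /=.
rewrite /B_act_fun /Sw scaler_sumr -big_split; apply: eq_bigr => p _ /=.
have lp : linear (fun x => N_act p.1 x) by lin.
exact: lp.
Qed.

Fact B_act_subproof h (b : B) : lspan (@B_gen k H A act) (B_act_fun h (lsub_val b)).
Proof.
apply: (lspan_map (B_act_fun_linear h) _ (lsubP b)).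
move=> _ [n [m ->]]; rewrite (B_act_fun_rank1 h n m); exact: lsubP.
Qed.
Definition B_act h (b : B) : B := in_lsub (B_act_subproof h b).

Lemma B_actE h b n :
  lsub_val (B_act h b) n = Sw h (fun h1 h2 => N_act h1 (lsub_val b (N_act (antipode h2) n))).
Proof. by []. Qed.

Lemma B_act_rank1 h n m :
  B_act h (rank1 n m) = Sw h (fun h1 h2 => rank1 (N_act h1 n) (M_act h2 m)).
Proof. by apply: lsub_inj; exact: B_act_fun_rank1. Qed.

Lemma linear_B_actr (U : lmodType k) h (f : U -> B) :
  linear f -> linear (fun u => B_act h (f u)).
Proof.
move=> lf c u v; apply: B_ext => n.
have l : linear (fun b : B => Sw h (fun h1 h2 => N_act h1 (lsub_val b (N_act (antipode h2) n)))).
  by lin.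
by rewrite lf; exact: l.
Qed.

Lemma linear_B_actl (U : lmodType k) b (f : U -> H) :
  linear f -> linear (fun u => B_act (f u) b).
Proof.
move=> lf c u v; apply: B_ext => n.
have l : linear (fun h => Sw h (fun h1 h2 => N_act h1 (lsub_val b (N_act (antipode h2) n)))).
  by lin.
by rewrite lf; exact: l.
Qed.

Lemma B_act1 b : B_act 1 b = b.
Proof.
apply: B_ext => n; rewrite B_actE Sw1; last by lin.
by rewrite antipode1 !N_act1.
Qed.

End ActionB.

Ltac lin_B := lazymatch goal with |- GRing.linear_for _ ?F => match F with
  | (fun u => B_act _ ?h (@?f u)) => refine (@linear_B_actr _ _ _ _ _ _ h f _)
  | (fun u => B_act _ (@?f u) ?b) => refine (@linear_B_actl _ _ _ _ _ _ b f _)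
  end end.
Ltac lin_step ::= first
  [ lin_B | lin_M | lin_mod | lin_tensor | lin_base | eassumption | lin_hyp ].

(** * Linear maps out of tensor products, and Sweedler sums of pairs *)

Section Lifts.
Variables (k : fieldType) (H : hopfAlgType k).
Implicit Type h : H.

Lemma linear_ex (U V : lmodType k) (f : U -> V) : linear f ->
  exists g : {linear U -> V}, forall x, g x = f x.
Proof.
move=> lf.
by exists (HB.pack_for {linear U -> V} f (GRing.isLinear.Build _ _ _ _ f lf)).
Qed.

Lemma tensor_lift_ex (U V W : lmodType k) (f : U -> V -> W) : bilin f ->
  exists g : {linear (U ⊗ V)%type -> W}, forall x y, g (x ⊗ y) = f x y.
Proof.
move=> bf; have [g gE] := linear_ex (tlift_is_linear bf).
by exists g => x y; rewrite gE tlift_tens.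
Qed.

Lemma tensor_over_lift_ex (A1 A2 A3 : nuAlgType k) (P : bimodule A1 A2)
    (Q : bimodule A2 A3) (V : lmodType k) (f : P -> Q -> V) : bilin f ->
    (forall p b q, f (p ⋅r b) q = f p (b ⋅l q)) ->
  exists g : {linear tensor_over P Q -> V}, forall p q, g (p ⊗b q) = f p q.
Proof.
move=> bf fb; have [t tE] := tensor_lift_ex bf.
have t0 v : balanced_rel v -> t v = 0.
  by move=> [p [b [q ->]]]; rewrite linearB /= !tE fb subrr.
have lift_linear : linear (fun x : tensor_over P Q => t (lrepr x)).
  move=> c x y; rewrite -[x in LHS]lreprK -[y in LHS]lreprK -linearP.
  by rewrite (lquot_lift t0) linearP.
have [g gE] := linear_ex lift_linear.
by exists g => p q; rewrite gE (lquot_lift t0) tE.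
Qed.

Lemma SwD (V : lmodType k) h (F G : H -> H -> V) :
  Sw h (fun x y => F x y + G x y) = Sw h F + Sw h G.
Proof. exact: big_split. Qed.

Lemma Sw_pair (V W : lmodType k) h (F : H -> H -> V) (G : H -> H -> W) :
  Sw h (fun x y => (F x y, G x y)) = (Sw h F, Sw h G).
Proof.
by rewrite [LHS]surjective_pairing (Sw_map (f := fst)) // (Sw_map (f := snd)).
Qed.

End Lifts.

(** * Product rules, spanning properties, annihilators of [B] and the context algebra *)

Section Context.
Variables (k : fieldType) (H : hopfAlgType k) (A : nuAlgType k).
Variable act : {linear (H ⊗ A)%type -> A}.
Hypothesis act_sym : symmetrical_partial_action act.
Local Notation "h ▷ a" := (act (h ⊗ a)) (at level 40, left associativity).
Local Notation N := (Nmod act).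
Local Notation M := (Mmod act).
Local Notation B := (Balg act).
Local Notation N_act := (N_act act_sym).
Local Notation M_act := (M_act act_sym).
Local Notation B_act := (B_act act_sym).
Implicit Types (g h : H) (a : A).

(** For [b] of rank one, the value of [b] is a right multiple with scalar in the image of
    evaluation, so [N_act_rmul1] and [act_app] apply in turn. *)
Lemma N_act_app h g b n :
  N_act h (lsub_val b (N_act g n)) =
  Sw h (fun h1 h2 => lsub_val (B_act h1 b) (N_act (h2 * g) n)).
Proof.
move: b; apply: B_lin_eq => [||n' m]; [by lin|by lin|].
rewrite [in LHS]/= N_act_rmul1.
transitivity (Sw h (fun h1 h2 => Sw h2 (fun p q =>
    N_rmul (N_act h1 n') (lsub_val (M_act p m) (N_act (q * g) n))))).
  apply: eq_Sw => h1 h2; rewrite act_app (Sw_map (f := N_rmul _)) //.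
  by lin.
rewrite -SwA; last by lin.
by apply: eq_Sw => h1 h2; rewrite B_act_rank1 lsub_Sw fun_SwE.
Qed.

Lemma rank1_rmul (n : N) a (m : M) : rank1 (N_rmul n a) m = rank1 n (M_lact a m).
Proof. by apply: B_ext => n' /=; rewrite N_rmulA. Qed.

Lemma B_mul_rank1 (b : B) (n : N) (m : M) : B_mul b (rank1 n m) = rank1 (lsub_val b n) m.
Proof. by apply: B_ext => n' /=; rewrite Balg_rmul. Qed.

Lemma M_ract_rank1 (m : M) (n : N) (m' : M) :
  M_ract m (rank1 n m') = M_lact (lsub_val m n) m'.
Proof. by apply: M_ext => n' /=; rewrite Mmod_rmul. Qed.

Hypothesis A_idem : idempotent_alg A.

Lemma Nmod_unital (n : N) : lspan (fun y => exists (n' : N) a, y = N_rmul n' a) n.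
Proof.
move: n; apply: lsub_ind_span => [v Sv||c x y hx hy]; last 2 first.
- exact: lspan0.
- exact: lspan_lin.
have [m [b [cm vE]]] := Sv.
rewrite (_ : in_lsub _ = in_lsub (coherent_N b cm)); last by apply: lsub_inj.
apply: (lspan_map (f := fun b => in_lsub (coherent_N b cm)) _ _ (A_idem b)).
  move=> c u w; apply: N_ext => l /=.
  by rewrite [LHS](linear_rmulr (m l) (@linear_id _ _)).
move=> _ [a [a' ->]]; apply: lspan_gen; exists (in_lsub (coherent_N a cm)), a'.
by apply: N_ext => l /=; rewrite rmulA.
Qed.

(** [M_act_lact] merges the actions of [h] and [g] in the presence of a factor from [A]. Such a
    factor is borrowed from [n], written as [n' a] by [Nmod_unital], and moved across by
    [rank1_rmul]. *)
Lemma B_act_rank1_act h g n m :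
  B_act h (rank1 n (M_act g m)) =
  Sw h (fun h1 h2 => rank1 (N_act h1 n) (M_act (h2 * g) m)).
Proof.
move: n (Nmod_unital n); apply: lspan_eq => [||_ [n' [a ->]]]; [by lin|by lin|].
rewrite rank1_rmul B_act_rank1.
transitivity (Sw h (fun h1 h2 => Sw h2 (fun p q =>
    rank1 (N_act h1 n') (M_lact (p ▷ a) (M_act (q * g) m))))).
  apply: eq_Sw => h1 h2; rewrite M_act_lact (Sw_map (f := rank1 _)) //.
  by lin.
rewrite -SwA; last by lin.
apply: eq_Sw => h1 h2; rewrite N_act_rmul1 (Sw_map (f := fun n => rank1 n _)); last by lin.
by apply: eq_Sw => p q; rewrite rank1_rmul.
Qed.

(** For [b] of rank one, right multiplication turns into left multiplication by the scalar [m(n)],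
    so [M_act_lact] and [act_app] suffice. *)
Lemma M_act_ract h g m b :
  M_act h (M_ract m (B_act g b)) =
  Sw h (fun h1 h2 => M_ract (M_act h1 m) (B_act (h2 * g) b)).
Proof.
move: b; apply: B_lin_eq => [||n m']; [by lin|by lin|].
transitivity (Sw h (fun h1 h2 => Sw h2 (fun p q => Sw g (fun r d =>
    M_lact (lsub_val (M_act h1 m) (N_act (p * r) n)) (M_act (q * d) m'))))).
  rewrite -SwA; last by lin.
  transitivity (Sw g (fun r d => Sw h (fun h1 h2 => Sw h1 (fun p q =>
      M_lact (lsub_val (M_act p m) (N_act (q * r) n)) (M_act (h2 * d) m'))))).
    rewrite B_act_rank1 (Sw_map (f := fun b => M_act h (M_ract m b))); last by lin.
    apply: eq_Sw => r d; rewrite M_ract_rank1 M_act_lact; apply: eq_Sw => h1 h2.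
    by rewrite act_app (Sw_map (f := fun a => M_lact a _)) //; lin.
  by rewrite Sw_exchange; apply: eq_Sw => h1 h2; exact: Sw_exchange.
apply: eq_Sw => h1 h2; rewrite B_act_rank1 SwM; last by lin.
rewrite (Sw_map (f := M_ract _)); last by lin.
apply: eq_Sw => p q; rewrite (Sw_map (f := M_ract _)); last by lin.
by apply: eq_Sw => r d; rewrite M_ract_rank1.
Qed.

(** For [b'] of rank one the product is again of rank one, with vector [b(n)]; [B_act_rank1_act] and
    [N_act_app] then suffice. *)
Lemma B_act_mul h g b b' :
  B_act h (B_mul b (B_act g b')) =
  Sw h (fun h1 h2 => B_mul (B_act h1 b) (B_act (h2 * g) b')).
Proof.
move: b'; apply: B_lin_eq => [||n m']; [by lin|by lin|].
transitivity (Sw h (fun h1 h2 => Sw h2 (fun p q => Sw g (fun r d =>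
    rank1 (lsub_val (B_act h1 b) (N_act (p * r) n)) (M_act (q * d) m'))))).
  rewrite -SwA; last by lin.
  transitivity (Sw g (fun r d => Sw h (fun h1 h2 => Sw h1 (fun p q =>
      rank1 (lsub_val (B_act p b) (N_act (q * r) n)) (M_act (h2 * d) m'))))).
    rewrite B_act_rank1 (Sw_map (f := fun b' => B_act h (B_mul b b'))); last by lin.
    apply: eq_Sw => r d; rewrite B_mul_rank1 B_act_rank1_act; apply: eq_Sw => h1 h2.
    by rewrite N_act_app (Sw_map (f := fun n => rank1 n _)) //; lin.
  by rewrite Sw_exchange; apply: eq_Sw => h1 h2; exact: Sw_exchange.
apply: eq_Sw => h1 h2; rewrite B_act_rank1 SwM; last by lin.
rewrite (Sw_map (f := B_mul _)); last by lin.
apply: eq_Sw => p q; rewrite (Sw_map (f := B_mul _)); last by lin.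
by apply: eq_Sw => r d; rewrite B_mul_rank1.
Qed.

(** Idempotence in the form needed for coherence: the decomposition is indexed by its left factors
    and holds over every large enough list. *)
Lemma decompose_ex b : exists d : A -> A, exists L : seq A,
  forall L', uniq L' -> {subset L <= L'} -> b = \sum_(a <- L') a ∙ d a.
Proof.
elim: (A_idem b) => [_ [x [y ->]]||c u v _ [d [L dL]] _ [d' [L' dL']]].
(* The default 0 away from [x] makes additional letters contribute nothing. *)
- exists (fun a => if a == x then y else 0), [:: x] => L' uL' /(_ x (mem_head _ _)) xL'.
  rewrite (bigD1_seq x) //= eqxx big1 ?addr0 // => a /negbTE ->.
  by rewrite (linear_fun0 (numul_bilin.2 a)).
- exists (fun=> 0), [::] => L' _ _; rewrite big1 // => a _.
  by rewrite (linear_fun0 (numul_bilin.2 a)).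
exists (fun a => c *: d a + d' a), (L ++ L') => L2 uL2 sL2.
rewrite {1}(dL L2) //; last by move=> a aL; apply: sL2; rewrite mem_cat aL.
rewrite {1}(dL' L2) //; last by move=> a aL; apply: sL2; rewrite mem_cat aL orbT.
rewrite scaler_sumr -big_split; apply: eq_bigr => a _ /=.
by rewrite (numul_bilin.2 a).
Qed.

(** Since absorption of [b] sends [1 ⊗ c] to [1 ⊗ (b ∙ c)], a coherent family arises by decomposing
    [a], then its right factors, and so on along each word. *)
Lemma coherent_ex a : exists2 n, coherent act n & n [::] = 1 ⊗ a.
Proof.
have [d dP] := choice decompose_ex.
(* The value at [b :: l] is the right factor that accompanies [b] in the decomposition of the value
   at [l]. *)
exists (fun l => 1 ⊗ foldr (fun b c => d c b) a l) => // l.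
have [L dL] := dP (foldr (fun b c => d c b) a l); exists L => L' uL' sL.
rewrite {1}(dL L' uL' sL) (linear_fun_sum ((tens_bilin H A).2 1)).
apply: eq_bigr => b _ /=; rewrite absorb_tens Sw1 ?(act1 act_sym) //.
by lin.
Qed.

(** Elements of [A] are sums of products [x ∙ (u ∙ v)]. Such a product is a value of evaluation:
    slice by the counit at the empty word a family starting with [1 ⊗ u], multiplied by [v]. *)
Lemma app_span a : lspan (fun y => exists (m : M) (n : N), y = lsub_val m n) a.
Proof.
apply: lspan_sub (A_idem a) => _ [x [y ->]].
apply: (lspan_map (numul_bilin.2 x) _ (A_idem y)) => _ [u [v ->]].
have [n cn n0] := coherent_ex u.
have lc : linear (@counit k H) by exact: linearP.
have Mg : M_gen (fun n : N => x ∙ slice (@counit k H) (lsub_val n [::])).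
  by exists x, [::], (@counit k H).
apply: lspan_gen; exists (in_lsub (lspan_gen Mg)), (in_lsub (coherent_N v cn)).
by rewrite /= n0 rmul_tens slice_tens // counit1 scale1r.
Qed.

Lemma M_lact_span (m : M) : lspan (fun y => exists a (m' : M), y = M_lact a m') m.
Proof.
move: m; apply: lsub_ind_span => [v Sv||c x y hx hy]; last 2 first.
- exact: lspan0.
- exact: lspan_lin.
have [b [l [xi [lxi vE]]]] := Sv.
have Mg a : M_gen (fun n : N => a ∙ slice xi (lsub_val n l)) by exists a, l, xi.
rewrite (_ : in_lsub _ = in_lsub (lspan_gen (Mg b))); last by apply: lsub_inj.
apply: (lspan_map (f := fun b => in_lsub (lspan_gen (Mg b))) _ _ (A_idem b)).
  by move=> c u w; apply: M_ext => n /=; rewrite [LHS](numul_bilin.1 _).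
move=> _ [a [a' ->]]; apply: lspan_gen; exists a, (in_lsub (lspan_gen (Mg a'))).
by apply: M_ext => n /=; rewrite numulA.
Qed.

(** In [a m'] the scalar [a] is a sum of values [m''(n)], and [m''(n) m'] is [m''] composed with
    [rank1 n m']. *)
Lemma M_ract_span (m : M) : lspan (fun y => exists (m' : M) (b : B), y = M_ract m' b) m.
Proof.
apply: lspan_sub (M_lact_span m) => _ [a [m' ->]].
apply: (lspan_map (f := fun a => M_lact a m') _ _ (app_span a)); first by lin.
move=> _ [m'' [n ->]]; apply: lspan_gen; exists m'', (rank1 n m').
by rewrite M_ract_rank1.
Qed.

Lemma B_app_span (n : N) : lspan (fun y => exists (b : B) (n' : N), y = lsub_val b n') n.
Proof.
apply: lspan_sub (Nmod_unital n) => _ [n' [a ->]].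
apply: (lspan_map (f := fun a => N_rmul n' a) _ _ (app_span a)); first by lin.
by move=> _ [m [n'' ->]]; apply: lspan_gen; exists (rank1 n' m), n''.
Qed.

Lemma rank1_span (b : B) : lspan (fun y => exists (n : N) (m : M), y = rank1 n m) b.
Proof.
move: b; apply: lsub_ind_span => [v Sv||c x y hx hy]; last 2 first.
- exact: lspan0.
- exact: lspan_lin.
have [n [m vE]] := Sv; apply: lspan_gen; exists n, m.
by apply: lsub_inj; rewrite /= vE.
Qed.

(** The vector of a rank-one operator is a sum of values [b'(n')], and [b'] then factors out on the
    left. *)
Lemma Balg_idempotent : idempotent_alg B.
Proof.
move=> b; apply: lspan_sub (rank1_span b) => _ [n [m ->]].
apply: (lspan_map (f := fun n => rank1 n m) _ _ (B_app_span n)); first by lin.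
move=> _ [b' [n' ->]]; apply: lspan_gen; exists b', (rank1 n' m).
by rewrite [RHS]B_mul_rank1.
Qed.

(* If [A m(n) = 0] for all [m], every slice of [n (a :: l)] is a right annihilator,
   so [absorb a] kills [n (a :: l)], and coherence gives [n l = 0]. *)
Lemma Nmod_eq0 (n : N) :
  (forall m : M, right_annihilator (lsub_val m n)) -> n = 0.
Proof.
move=> mn; apply: N_ext => l; have [L nL] := Nmod_coherent n l.
rewrite (nL (undup L)) ?undup_uniq // => [|a]; last by rewrite mem_undup.
rewrite big1 // => a _; apply: absorb_eq0 => xi lxi c.
(* It suffices to take [c = x ∙ y]: then [y] times the slice is the value at [n] of an element of
   [M], which [x] kills. *)
apply: (lspan_eq (f := fun c => c ∙ _) (g := fun=> 0) _ _ _ (A_idem c)).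
- by lin.
- exact: linear_zero.
move=> _ [x [y ->]]; rewrite -numulA.
have Mg : M_gen (fun n : N => y ∙ slice xi (lsub_val n (a :: l))) by exists y, (a :: l), xi.
exact: mn (in_lsub (lspan_gen Mg)) x.
Qed.

(** If [B b = 0], then [n' m(b(n)) = 0] for all [n'] and [m]. Applying [m'] gives
    [m'(n') m(b(n)) = 0]; the scalars [m'(n')] span [A], so [Nmod_eq0] applies to [b(n)]. *)
Lemma Balg_right_annihilator : trivial_right_annihilator B.
Proof.
move=> b bb; apply: B_ext => n; apply: Nmod_eq0 => m c.
apply: (lspan_eq (f := fun c => c ∙ _) (g := fun=> 0) _ _ _ (app_span c)).
- by lin.
- exact: linear_zero.
move=> _ [m' [n' ->]]; rewrite -Mmod_rmul.
have /(congr1 (fun b => lsub_val b n)) /= -> := bb (rank1 n' m).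
exact: linear_fun0 (Mmod_linear m').
Qed.

(** If [b B = 0], then [b] kills every [b'(n')], and these span [N]. *)
Lemma Balg_left_annihilator : trivial_left_annihilator B.
Proof.
move=> b bb; apply: B_ext => n.
apply: (lspan_eq (f := fun n => lsub_val b n) (g := fun=> 0) _ _ _ (B_app_span n)).
- by lin.
- exact: linear_zero.
move=> _ [b' [n' ->]].
by have /(congr1 (fun b => lsub_val b n')) := bb b'.
Qed.

Definition bimod_M : bimodule A B.
Proof.
apply: (@Bimodule k A B M (@M_lact k H A act) (@M_ract k H A act)).
- by split=> ?; lin.
- by split=> ?; lin.
- by move=> a a' m; apply: M_ext => n /=; rewrite numulA.
- by move=> m b b'; apply: M_ext => n.
- by move=> a m b; apply: M_ext => n.
Defined.

Definition bimod_N : bimodule B A.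
Proof.
apply: (@Bimodule k B A N (fun b n => lsub_val b n) (@N_rmul k H A act)).
- by split=> ?; lin.
- by split=> ?; lin.
- by [].
- by move=> n a a'; rewrite N_rmulA.
- by move=> b n a; rewrite Balg_rmul.
Defined.

Lemma B_partial_action (actB : {linear (H ⊗ B)%type -> B}) :
  (forall h b, actB (h ⊗ b) = B_act h b) -> partial_action actB.
Proof.
move=> actBE; split=> [b|h g b b']; first by rewrite actBE B_act1.
rewrite tlift_comul; last by lin.
transitivity (B_act h (B_mul b (B_act g b'))).
  exact: etrans (actBE _ _) (congr1 (fun z => B_act h (B_mul b z)) (actBE g b')).
rewrite B_act_mul; apply: eq_Sw => h1 h2.
by rewrite -(actBE h1 b) -(actBE (h2 * g) b').
Qed.

Lemma Balg_morita_equivalent (actB : {linear (H ⊗ B)%type -> B}) :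
  (forall h b, actB (h ⊗ b) = B_act h b) -> partial_morita_equivalent act actB.
Proof.
move=> actBE.
have [tau tauE] := @tensor_over_lift_ex k A B A bimod_M bimod_N A
  (fun m n => lsub_val m n) ltac:(split=> ?; lin) ltac:(by []).
have [sigma sigmaE] := @tensor_over_lift_ex k B A B bimod_N bimod_M B
  (@rank1 k H A act) ltac:(split=> ?; lin) rank1_rmul.
have X_tl a (m : bimod_M) (n : bimod_N) : tau ((a ⋅l m) ⊗b n) = a ∙ tau (m ⊗b n).
  by rewrite [LHS](tauE (a ⋅l m) n) [RHS](congr1 (numul a) (tauE m n)).
have X_tr (m : bimod_M) (n : bimod_N) a : tau (m ⊗b (n ⋅r a)) = tau (m ⊗b n) ∙ a.
  rewrite [LHS](tauE m (n ⋅r a)) [RHS](congr1 (fun z => z ∙ a) (tauE m n)).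
  exact: Mmod_rmul.
have X_sl b (n : bimod_N) (m : bimod_M) : sigma ((b ⋅l n) ⊗b m) = b ∙ sigma (n ⊗b m).
  rewrite [LHS](sigmaE (b ⋅l n) m) [RHS](congr1 (B_mul b) (sigmaE n m)).
  exact/esym/B_mul_rank1.
have X_sr (n : bimod_N) (m : bimod_M) b : sigma (n ⊗b (m ⋅r b)) = sigma (n ⊗b m) ∙ b.
  rewrite [LHS](sigmaE n (m ⋅r b)) [RHS](congr1 (fun z => B_mul z b) (sigmaE n m)).
  exact: B_ext.
have X_ts (m : bimod_M) (n : bimod_N) (m' : bimod_M) :
    tau (m ⊗b n) ⋅l m' = m ⋅r sigma (n ⊗b m').
  rewrite [LHS](congr1 (fun z => M_lact z m') (tauE m n)).
  by rewrite [RHS](congr1 (M_ract m) (sigmaE n m')) [RHS]M_ract_rank1.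
have X_st (n : bimod_N) (m : bimod_M) (n' : bimod_N) :
    sigma (n ⊗b m) ⋅l n' = n ⋅r tau (m ⊗b n').
  rewrite [LHS](congr1 (fun z : B => lsub_val z n') (sigmaE n m)).
  by rewrite [RHS](congr1 (N_rmul n) (tauE m n')).
pose Xc := MoritaContext X_tl X_tr X_sl X_sr X_ts X_st.
exists Xc; split.
(* Both maps are linear, so surjectivity follows from the spanning sets [app_span] and
   [rank1_span]. *)
- split=> [a|b].
    elim: (app_span a) => [_ [m [n ->]]||c u v _ [s <-] _ [t <-]].
    + by exists ((m : bimod_M) ⊗b (n : bimod_N)); rewrite [LHS]tauE.
    + by exists 0; rewrite linear0.
    + by exists (c *: s + t); rewrite linearP.
  elim: (rank1_span b) => [_ [n [m ->]]||c u v _ [s <-] _ [t <-]].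
  + by exists ((n : bimod_N) ⊗b (m : bimod_M)); rewrite [LHS]sigmaE.
  + by exists 0; rewrite linear0.
  + by exists (c *: s + t); rewrite linearP.
- split=> m; first exact: (M_lact_span m).
  exact: (M_ract_span m).
- split=> n; first exact: (B_app_span n).
  exact: (Nmod_unital n).
(* [H] acts on matrices entry by entry. *)
pose actC_fun h (x : context_alg Xc) : context_alg Xc :=
  ((h ▷ x.1.1, M_act h x.1.2), (N_act h x.2.1, B_act h x.2.2)).
have bC : bilin actC_fun.
  have pair_linear (U V W : lmodType k) (f : U -> V) (f' : U -> W) :
      linear f -> linear f' -> linear (fun u => (f u, f' u)).
    by move=> lf lf' c u v; rewrite lf lf'.
  by split=> ?; apply: (pair_linear); apply: (pair_linear); lin.
have [actC actCE] := tensor_lift_ex bC.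
exists actC; split; first split.
- move=> x; rewrite [LHS](actCE 1 x) /actC_fun (act1 act_sym) M_act1 N_act1 B_act1.
  by case: x => [[? ?] [? ?]].
- move=> h g x y; rewrite tlift_comul; last by lin.
  rewrite [LHS](congr1 (fun z => actC (h ⊗ (x ∙ z))) (actCE g y)) [LHS](actCE h _).
  transitivity (Sw h (fun h1 h2 =>
      context_mul (actC_fun h1 x) (actC_fun (h2 * g) y))); last first.
    by apply: eq_Sw => h1 h2; rewrite -(actCE h1 x) -(actCE (h2 * g) y).
  case: x y => [[a m] [n b]] [[a' m'] [n' b']].
  (* The axiom is checked in each of the four entries; every entry is a sum of two products, each
     with its own product rule from above. *)
  have EA : h ▷ (a ∙ (g ▷ a') + tau ((m : bimod_M) ⊗b (N_act g n' : bimod_N))) =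
      Sw h (fun h1 h2 => (h1 ▷ a) ∙ ((h2 * g) ▷ a') +
        tau ((M_act h1 m : bimod_M) ⊗b (N_act (h2 * g) n' : bimod_N))).
    rewrite SwD [LHS](linear_funD (f := fun z => h ▷ z)); last by lin.
    congr (_ + _); first exact: act_mul.
    rewrite [LHS](congr1 (fun z => h ▷ z) (tauE m (N_act g n'))) act_app.
    by apply: eq_Sw => h1 h2; rewrite [RHS](tauE (M_act h1 m) (N_act (h2 * g) n')).
  have EM : M_act h (M_lact a (M_act g m') + M_ract m (B_act g b')) =
      Sw h (fun h1 h2 => M_lact (h1 ▷ a) (M_act (h2 * g) m') +
        M_ract (M_act h1 m) (B_act (h2 * g) b')).
    rewrite SwD [LHS](linear_funD (f := fun z => M_act h z)); last by lin.
    by rewrite M_act_lact M_act_ract.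
  have EN : N_act h (N_rmul n (g ▷ a') + lsub_val b (N_act g n')) =
      Sw h (fun h1 h2 => N_rmul (N_act h1 n) ((h2 * g) ▷ a') +
        lsub_val (B_act h1 b) (N_act (h2 * g) n')).
    rewrite SwD [LHS](linear_funD (f := fun z => N_act h z)); last by lin.
    by rewrite N_act_rmul N_act_app.
  have EB : B_act h (sigma ((n : bimod_N) ⊗b (M_act g m' : bimod_M)) + B_mul b (B_act g b')) =
      Sw h (fun h1 h2 => sigma ((N_act h1 n : bimod_N) ⊗b (M_act (h2 * g) m' : bimod_M)) +
        B_mul (B_act h1 b) (B_act (h2 * g) b')).
    rewrite SwD [LHS](linear_funD (f := fun z => B_act h z)); last by lin.
    rewrite B_act_mul; congr (_ + _).
    rewrite [LHS](congr1 (B_act h) (sigmaE n (M_act g m'))).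
    rewrite [LHS]B_act_rank1_act.
    by apply: eq_Sw => h1 h2; rewrite [RHS](sigmaE (N_act h1 n) (M_act (h2 * g) m')).
  transitivity ((h ▷ (a ∙ (g ▷ a') + tau ((m : bimod_M) ⊗b (N_act g n' : bimod_N))),
      M_act h (M_lact a (M_act g m') + M_ract m (B_act g b'))),
    (N_act h (N_rmul n (g ▷ a') + lsub_val b (N_act g n')),
      B_act h (sigma ((n : bimod_N) ⊗b (M_act g m' : bimod_M)) + B_mul b (B_act g b')))).
    by [].
  by rewrite EA EM EN EB -!Sw_pair.
- move=> h a; rewrite [LHS](actCE h _) /actC_fun /context_inA /=.
  rewrite (linear_fun0 (f := M_act h)); last by lin.
  rewrite (linear_fun0 (f := N_act h)); last by lin.
  by rewrite (linear_fun0 (f := B_act h)) //; lin.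
- move=> h b; rewrite [LHS](actCE h _) /actC_fun /context_inB /=.
  rewrite (linear_fun0 (f := fun a => h ▷ a)); last by lin.
  rewrite (linear_fun0 (f := M_act h)); last by lin.
  rewrite (linear_fun0 (f := N_act h)); last by lin.
  by rewrite -(actBE h b).
Qed.

End Context.

Theorem theorem86 (k : fieldType) (H : hopfAlgType k) (A : nuAlgType k)
    (actA : {linear (H ⊗ A)%type -> A}) :
  idempotent_alg A -> symmetrical_partial_action actA ->
  (exists (B : nuAlgType k) (actB : {linear (H ⊗ B)%type -> B}),
     [/\ idempotent_alg B, trivial_right_annihilator B,
         partial_action actB & partial_morita_equivalent actA actB]) /\
  (exists (B : nuAlgType k) (actB : {linear (H ⊗ B)%type -> B}),
     [/\ idempotent_alg B, trivial_left_annihilator B,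
         partial_action actB & partial_morita_equivalent actA actB]).
Proof.
move=> idA symA.
have bB : bilin (B_act symA).
  by split=> ?; [exact/linear_B_actl/linear_id|exact/linear_B_actr/linear_id].
have [actB actBE] := tensor_lift_ex bB.
have [idB pB mB] : [/\ idempotent_alg (Balg actA), partial_action actB
    & partial_morita_equivalent actA actB].
  split; [exact: Balg_idempotent|exact: B_partial_action|].
  exact: Balg_morita_equivalent.
(* One and the same [B] has both annihilators trivial. *)
split; exists (Balg actA), actB; split=> //.
  exact: Balg_right_annihilator.
exact: Balg_left_annihilator.
Qed.
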